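(* For $\nu=1$ and $\nu=2$, the rational map $$(w,x,y)\mapsto [F_{\nu 0}:F_{\nu 1}:F_{\nu 2}]\in\mathbb{P}^2$$ on $X$ induces a morphism $\phi_\nu:X\to\mathbb{P}^2$ of degree $2$.
   Context: Let $k$ be an algebraically closed field of characteristic $3$, let $i=\sqrt{-1}\in k$, and $\mathbb{F}_9=\mathbb{F}_3(i)\subset k$. Let $X=\{w^4+x^4+y^4+z^4=0\}\subset\mathbb{P}^3_k$ be the Fermat quartic surface, and let $(w,x,y)$ be the affine coordinates of $\mathbb{P}^3$ with $z=1$. The polynomials $F_{\nu j}\in\mathbb{F}_9[w,x,y]$ ($\nu=1,2$; $j=0,1,2$) are: $F_{10}=(1+i)+(1+i)w+(1-i)x-y-(1-i)wx-x^2+iwy+ixy-iy^2+(1+i)w^3-iw^2x+(1+i)wx^2-ix^3+w^2y+(1+i)wxy+(1+i)x^2y-(1-i)wy^2-(1+i)xy^2+iy^3$, $F_{11}=(1-i)-(1+i)x-(1-i)y-(1-i)w^2-(1-i)wx-(1-i)x^2-(1+i)wy-xy-(1+i)y^2-w^3+(1-i)w^2x+wx^2-ix^3-(1+i)w^2y-(1+i)wxy+x^2y-iwy^2-xy^2+(1-i)y^3$, $F_{12}=(1+i)w-ix-y-w^2-wx-ix^2-ixy+iy^2+iw^3-(1+i)wx^2+ix^3-iw^2y-wxy+(1-i)wy^2+(1+i)y^3$, $F_{20}=-1-iw+(1+i)x-y-(1+i)w^2-wx-(1-i)x^2-iwy+(1+i)xy-(1-i)w^3+w^2x-wx^2+x^3-w^2y+(1-i)wxy+x^2y+(1-i)wy^2+(1-i)xy^2+(1+i)y^3-w^3x-iw^2x^2-wx^3+w^3y-(1+i)w^2xy-(1-i)wxy^2+x^2y^2-(1-i)wy^3-(1+i)xy^3-y^4+(1-i)w^3x^2-ix^5+(1-i)w^3xy+(1+i)wx^3y-iw^3y^2+(1+i)w^2xy^2-(1+i)wx^2y^2+ix^3y^2-w^2y^3-(1+i)wxy^3-(1-i)x^2y^3+iwy^4+(1-i)xy^4+(1+i)y^5$,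 $F_{21}=-(1-i)+iw+(1-i)y-(1+i)w^2+wx+(1+i)x^2+(1+i)wy-(1+i)xy-iy^2-w^3+iw^2x+(1+i)wx^2-x^3-(1+i)w^2y-(1-i)wxy-(1-i)x^2y-iwy^2-(1+i)xy^2+y^3-(1-i)w^3x-wx^3+(1-i)x^4+(1-i)w^3y+iw^2xy+(1-i)wx^2y-ix^3y+(1-i)w^2y^2+(1-i)wxy^2-(1+i)x^2y^2+(1-i)wy^3-ixy^3+iy^4+w^3x^2+w^2x^3+(1-i)wx^4-ix^5-iw^3xy+w^2x^2y+(1+i)wx^3y+x^4y+w^3y^2-w^2xy^2-wx^2y^2+iw^2y^3+(1+i)wxy^3-iwy^4-ixy^4+y^5$, $F_{22}=(1-i)-(1+i)w-(1+i)x-(1-i)y+iw^2-(1+i)wx-(1-i)x^2+iwy-(1+i)xy-w^3-iw^2x-wx^2+x^3-(1-i)w^2y+wxy+x^2y+(1+i)wy^2-(1+i)xy^2-y^3+iw^3x-(1-i)w^2x^2-wx^3-(1+i)x^4+iw^3y+w^2xy+(1-i)wx^2y-(1-i)w^2y^2+(1+i)wxy^2+iwy^3+xy^3+(1-i)y^4-iw^3x^2-(1+i)wx^4+x^5-(1-i)w^3xy-iw^2x^2y+(1+i)wx^3y+(1-i)x^4y-w^3y^2-(1+i)w^2xy^2+iwx^2y^2+ix^3y^2-wxy^3-(1-i)x^2y^3-wy^4-xy^4-y^5$. *)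

(* Defs.v *)
From HB Require Import structures.
From mathcomp Require Import all_boot all_order all_algebra ring_quotient fraction.
From mathcomp Require Import boolp mpoly.

Set Implicit Arguments.
Unset Strict Implicit.
Unset Printing Implicit Defensive.

Import GRing.Theory.

Local Open Scope ring_scope.
Local Open Scope quotient_scope.

Section ProjectiveSpace.
Variable k : closedFieldType.

(* P^n is the set of lines through the origin in k^(n+1). *)
Definition proj (n : nat) :=
  {L : {vspace 'rV[k]_n.+1} | \dim L == 1%N}.

(* For a homogeneous p this is p(P) = 0. For an arbitrary p it says that all
   homogeneous components of p vanish at P, because k is infinite. *)
Definition vanishes_at n (p : {mpoly k[n.+1]}) (P : proj n) : Prop :=
  forall v : 'rV[k]_n.+1, v \in val P -> p.@[v 0] = 0.

(* Q = [G_0(P) : ... : G_m(P)]. As Q has dimension 1, the equality forces the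
   values G_j(v) not to be all zero. *)
Definition evaluates_to n m (G : (m.+1).-tuple {mpoly k[n.+1]})
    (P : proj n) (Q : proj m) : Prop :=
  forall v : 'rV[k]_n.+1, v \in val P -> v != 0 ->
    val Q = <[\row_j (tnth G j).@[v 0%R]]>%VS.

End ProjectiveSpace.

Section RegularMaps.
Variables (k : closedFieldType) (n m : nat) (V : proj k n -> Prop).
Variable phi : {P : proj k n | V P} -> proj k m.

(* On the principal open subset h <> 0 of V, the map phi is given by the forms
   G_0, ..., G_m of a common degree without common zero there. *)
Definition given_by (h : {mpoly k[n.+1]}) (G : (m.+1).-tuple {mpoly k[n.+1]})
    : Prop :=
  [/\ exists e, h \is e.-homog,
      exists d, forall j, tnth G j \is d.-homog &
      forall P, ~ vanishes_at h (sval P) -> evaluates_to G (sval P) (phi P)].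

Definition is_morphism : Prop :=
  forall P : {P | V P}, exists h G, given_by h G /\ ~ vanishes_at h (sval P).

Definition dominant : Prop :=
  forall d (b : {mpoly k[m.+1]}), b \is d.-homog ->
    (forall P, vanishes_at b (phi P)) -> b = 0.

End RegularMaps.

Section FunctionField.
Variables (k : closedFieldType) (n : nat) (V : proj k n -> Prop).

Definition in_ideal : {pred {mpoly k[n.+1]}} :=
  fun p => `[< forall P, V P -> vanishes_at p P >].

(* V is irreducible if and only if it is nonempty and I(V) is prime. *)
Definition irreducible_set : Prop :=
  (exists P, V P) /\ prime_idealr_closed in_ideal.

Lemma in_ideal_closed (irr : irreducible_set) : idealr_closed in_ideal.
Proof.
case: irr => -[P VP] _; split.
- by apply/asboolP => Q _ v _; rewrite meval0.
- apply/asboolP => /(_ P VP 0 (mem0v _)); rewrite meval1.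
  by move/eqP; rewrite oner_eq0.
- move=> a p q /asboolP pI /asboolP qI; apply/asboolP => Q VQ v vQ.
  by rewrite mevalD mevalM (pI Q VQ v vQ) (qI Q VQ v vQ) mulr0 addr0.
Qed.

(* The homogeneous ideal I(V), with the irreducibility of V as a phantom
   argument so that it is canonically a prime ideal. *)
Definition vanishing_ideal (irr : irreducible_set) : {pred {mpoly k[n.+1]}} :=
  in_ideal.

HB.instance Definition _ (irr : irreducible_set) :=
  isIdealr.Build {mpoly k[n.+1]} (vanishing_ideal irr) (in_ideal_closed irr).
HB.instance Definition _ (irr : irreducible_set) :=
  isPrimeIdealrClosed.Build {mpoly k[n.+1]} (vanishing_ideal irr) irr.2.

Definition coord_ring (irr : irreducible_set) :=
  {ideal_quot (vanishing_ideal irr)}.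

Section Domain.
Variable irr : irreducible_set.
Notation S := (coord_ring irr).

HB.instance Definition _ := GRing.ComNzRing.on S.
HB.instance Definition _ := EqQuotient.on S.

Definition coord_unit : pred S := fun x => `[< exists y, y * x == 1 >].
Definition coord_inv (x : S) : S :=
  if pselect (exists y, y * x == 1) is left ex then xchoose ex else x.

Fact coord_mulVx : {in coord_unit, left_inverse 1 coord_inv *%R}.
Proof.
move=> x /asboolP ux; rewrite /coord_inv; case: pselect => // ex.
exact/eqP/(xchooseP ex).
Qed.

Fact coord_unitPl (x y : S) : y * x = 1 -> coord_unit x.
Proof. by move=> yx1; apply/asboolP; exists y; rewrite yx1. Qed.

Fact coord_inv_out : {in [predC coord_unit], coord_inv =1 id}.
Proof.
by move=> x /asboolP nux; rewrite /coord_inv; case: pselect.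
Qed.

HB.instance Definition _ := GRing.ComNzRing_hasMulInverse.Build S
  coord_mulVx coord_unitPl coord_inv_out.
HB.instance Definition _ := GRing.ComUnitRing_isIntegral.Build S
  (@Quotient.rquot_IdomainAxiom _ (vanishing_ideal irr)).

Definition to_frac (p : {mpoly k[n.+1]}) : {fraction S} :=
  tofrac (\pi_S p : S).

(* k(V): the elements of degree 0 in the fraction field of the homogeneous
   coordinate ring. *)
Definition function_field (f : {fraction S}) : Prop :=
  exists d a b, [/\ a \is d.-homog, b \is d.-homog, b \notin vanishing_ideal irr
                  & f = to_frac a / to_frac b].

(* phi^* k(P^m): the pullbacks by phi of the a / b with a and b forms of the
   same degree, computed on a nonempty open subset of V where phi is given by
   forms; by irreducibility of V, the result does not depend on that subset. *)
Definition pullback_field m (phi : {P : proj k n | V P} -> proj k m)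
    (f : {fraction S}) : Prop :=
  exists h G d (a b : {mpoly k[m.+1]}),
    [/\ given_by phi h G /\ h \notin vanishing_ideal irr,
        a \is d.-homog, b \is d.-homog, b \mPo G \notin vanishing_ideal irr
      & f = to_frac (a \mPo G) / to_frac (b \mPo G)].

End Domain.
End FunctionField.

(* [E : F] = d for subfields F <= E of Omega given by predicates: E has a basis
   of d elements over F. *)
Definition extension_degree (Omega : fieldType) (E F : Omega -> Prop) (d : nat)
    : Prop :=
  exists e : 'I_d -> Omega, (forall j, E (e j)) /\
    forall x, E x -> exists! c : {ffun 'I_d -> Omega},
      (forall j, F (c j)) /\ x = \sum_j c j * e j.

(* The degree of a dominant morphism phi : V -> P^m is [k(V) : phi^* k(P^m)]. *)
Definition has_degree (k : closedFieldType) (n m : nat) (V : proj k n -> Prop)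
    (phi : {P : proj k n | V P} -> proj k m) (d : nat) : Prop :=
  dominant phi /\
  exists irr : irreducible_set V,
    extension_degree (@function_field k n V irr)
      (@pullback_field k n V irr m phi) d.

(* [w : x : y : z] has the coordinates of index 0, 1, 2, 3. *)
Definition fermat_quartic (k : closedFieldType) (P : proj k 3) : Prop :=
  vanishes_at (\sum_(j < 4) 'X_j ^+ 4) P.

Section RationalMap.
Variables (k : closedFieldType) (V : proj k 3 -> Prop).
Variable F : 'I_3 -> {mpoly k[3]}.

(* v is the vector (w, x, y, 1) of the affine point c = (w, x, y). *)
Definition affine_vector (c : 'I_3 -> k) : 'rV[k]_4 :=
  \row_(j < 4) if insub (val j) is Some l then c l else 1.

Definition defined_at (c : 'I_3 -> k) : Prop := exists j, (F j).@[c] != 0.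

(* The rational map (w, x, y) |-> [F_0 : F_1 : F_2] is defined somewhere on V,
   and phi extends it. *)
Definition rational_map_induces (phi : {P : proj k 3 | V P} -> proj k 2) : Prop :=
  (exists P c, [/\ V P, affine_vector c \in val P & defined_at c]) /\
  forall (P : {P | V P}) c, affine_vector c \in val (sval P) -> defined_at c ->
    val (phi P) = <[\row_(j < 3) (F j).@[c]]>%VS.

End RationalMap.

Section Polynomials.
Variables (k : closedFieldType) (i0 : k).

Let i : {mpoly k[3]} := i0%:MP.
Let w : {mpoly k[3]} := 'X_0.
Let x : {mpoly k[3]} := 'X_1.
Let y : {mpoly k[3]} := 'X_2.

Definition F10 : {mpoly k[3]} :=
    (1 + i) + (1 + i) * w + (1 - i) * x - y - (1 - i) * w * x - x ^+ 2
    + i * w * y + i * x * y - i * y ^+ 2 + (1 + i) * w ^+ 3 - i * w ^+ 2 * x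
    + (1 + i) * w * x ^+ 2 - i * x ^+ 3 + w ^+ 2 * y + (1 + i) * w * x * y
    + (1 + i) * x ^+ 2 * y - (1 - i) * w * y ^+ 2 - (1 + i) * x * y ^+ 2
    + i * y ^+ 3.

Definition F11 : {mpoly k[3]} :=
    (1 - i) - (1 + i) * x - (1 - i) * y - (1 - i) * w ^+ 2 - (1 - i) * w * x
    - (1 - i) * x ^+ 2 - (1 + i) * w * y - x * y - (1 + i) * y ^+ 2 - w ^+ 3
    + (1 - i) * w ^+ 2 * x + w * x ^+ 2 - i * x ^+ 3 - (1 + i) * w ^+ 2 * y
    - (1 + i) * w * x * y + x ^+ 2 * y - i * w * y ^+ 2 - x * y ^+ 2
    + (1 - i) * y ^+ 3.

Definition F12 : {mpoly k[3]} :=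
    (1 + i) * w - i * x - y - w ^+ 2 - w * x - i * x ^+ 2 - i * x * y
    + i * y ^+ 2 + i * w ^+ 3 - (1 + i) * w * x ^+ 2 + i * x ^+ 3
    - i * w ^+ 2 * y - w * x * y + (1 - i) * w * y ^+ 2 + (1 + i) * y ^+ 3.

Definition F20 : {mpoly k[3]} :=
    - 1 - i * w + (1 + i) * x - y - (1 + i) * w ^+ 2 - w * x
    - (1 - i) * x ^+ 2 - i * w * y + (1 + i) * x * y - (1 - i) * w ^+ 3
    + w ^+ 2 * x - w * x ^+ 2 + x ^+ 3 - w ^+ 2 * y + (1 - i) * w * x * y
    + x ^+ 2 * y + (1 - i) * w * y ^+ 2 + (1 - i) * x * y ^+ 2
    + (1 + i) * y ^+ 3 - w ^+ 3 * x - i * w ^+ 2 * x ^+ 2 - w * x ^+ 3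
    + w ^+ 3 * y - (1 + i) * w ^+ 2 * x * y - (1 - i) * w * x * y ^+ 2
    + x ^+ 2 * y ^+ 2 - (1 - i) * w * y ^+ 3 - (1 + i) * x * y ^+ 3 - y ^+ 4
    + (1 - i) * w ^+ 3 * x ^+ 2 - i * x ^+ 5 + (1 - i) * w ^+ 3 * x * y
    + (1 + i) * w * x ^+ 3 * y - i * w ^+ 3 * y ^+ 2
    + (1 + i) * w ^+ 2 * x * y ^+ 2 - (1 + i) * w * x ^+ 2 * y ^+ 2
    + i * x ^+ 3 * y ^+ 2 - w ^+ 2 * y ^+ 3 - (1 + i) * w * x * y ^+ 3
    - (1 - i) * x ^+ 2 * y ^+ 3 + i * w * y ^+ 4 + (1 - i) * x * y ^+ 4
    + (1 + i) * y ^+ 5.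

Definition F21 : {mpoly k[3]} :=
    - (1 - i) + i * w + (1 - i) * y - (1 + i) * w ^+ 2 + w * x
    + (1 + i) * x ^+ 2 + (1 + i) * w * y - (1 + i) * x * y - i * y ^+ 2
    - w ^+ 3 + i * w ^+ 2 * x + (1 + i) * w * x ^+ 2 - x ^+ 3
    - (1 + i) * w ^+ 2 * y - (1 - i) * w * x * y - (1 - i) * x ^+ 2 * y
    - i * w * y ^+ 2 - (1 + i) * x * y ^+ 2 + y ^+ 3 - (1 - i) * w ^+ 3 * x
    - w * x ^+ 3 + (1 - i) * x ^+ 4 + (1 - i) * w ^+ 3 * y
    + i * w ^+ 2 * x * y + (1 - i) * w * x ^+ 2 * y - i * x ^+ 3 * y
    + (1 - i) * w ^+ 2 * y ^+ 2 + (1 - i) * w * x * y ^+ 2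
    - (1 + i) * x ^+ 2 * y ^+ 2 + (1 - i) * w * y ^+ 3 - i * x * y ^+ 3
    + i * y ^+ 4 + w ^+ 3 * x ^+ 2 + w ^+ 2 * x ^+ 3 + (1 - i) * w * x ^+ 4
    - i * x ^+ 5 - i * w ^+ 3 * x * y + w ^+ 2 * x ^+ 2 * y
    + (1 + i) * w * x ^+ 3 * y + x ^+ 4 * y + w ^+ 3 * y ^+ 2
    - w ^+ 2 * x * y ^+ 2 - w * x ^+ 2 * y ^+ 2 + i * w ^+ 2 * y ^+ 3
    + (1 + i) * w * x * y ^+ 3 - i * w * y ^+ 4 - i * x * y ^+ 4 + y ^+ 5.

Definition F22 : {mpoly k[3]} :=
    (1 - i) - (1 + i) * w - (1 + i) * x - (1 - i) * y + i * w ^+ 2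
    - (1 + i) * w * x - (1 - i) * x ^+ 2 + i * w * y - (1 + i) * x * y
    - w ^+ 3 - i * w ^+ 2 * x - w * x ^+ 2 + x ^+ 3 - (1 - i) * w ^+ 2 * y
    + w * x * y + x ^+ 2 * y + (1 + i) * w * y ^+ 2 - (1 + i) * x * y ^+ 2
    - y ^+ 3 + i * w ^+ 3 * x - (1 - i) * w ^+ 2 * x ^+ 2 - w * x ^+ 3
    - (1 + i) * x ^+ 4 + i * w ^+ 3 * y + w ^+ 2 * x * y
    + (1 - i) * w * x ^+ 2 * y - (1 - i) * w ^+ 2 * y ^+ 2
    + (1 + i) * w * x * y ^+ 2 + i * w * y ^+ 3 + x * y ^+ 3
    + (1 - i) * y ^+ 4 - i * w ^+ 3 * x ^+ 2 - (1 + i) * w * x ^+ 4 + x ^+ 5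
    - (1 - i) * w ^+ 3 * x * y - i * w ^+ 2 * x ^+ 2 * y
    + (1 + i) * w * x ^+ 3 * y + (1 - i) * x ^+ 4 * y - w ^+ 3 * y ^+ 2
    - (1 + i) * w ^+ 2 * x * y ^+ 2 + i * w * x ^+ 2 * y ^+ 2
    + i * x ^+ 3 * y ^+ 2 - w * x * y ^+ 3 - (1 - i) * x ^+ 2 * y ^+ 3
    - w * y ^+ 4 - x * y ^+ 4 - y ^+ 5.

Definition F1 (j : 'I_3) : {mpoly k[3]} := tnth [tuple F10; F11; F12] j.
Definition F2 (j : 'I_3) : {mpoly k[3]} := tnth [tuple F20; F21; F22] j.

End Polynomials.

(* Main.v *)
Require Import Defs.
From HB Require Import structures.
From Stdlib Require Import BinNat BinPos Ring_polynom Ring_theory.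
From mathcomp Require Import all_boot all_order all_algebra.
From mathcomp Require Import ring_quotient fraction boolp ring mpoly.

(** Let X be the Fermat quartic surface in characteristic 3.

    The three polynomials F0, F1, F2, made homogeneous, vanish together along
    some lines of X. On X they are proportional to two further triples of
    forms, and the three triples together have no common zero, because some
    power of each of x, y, z is a linear combination of all these forms modulo
    the equation of X, and x = y = z = 0 implies w = 0 on X. So they define a
    morphism phi from X to the plane (morphism_of_representatives).

    The ideal of X is prime (cone_prime): modulo this ideal a polynomial is a
    cubic polynomial in z over k[w, x, y], its norm to k[w, x, y] is a product
    of the polynomial by another one, and a polynomial of norm 0 is 0 because
    w^4 + x^4 + y^4 and its opposite are not squares.

    Dominance (fermat_comp_eq0): phi maps some line of X onto a line of the
    plane. If b(F0, F1, F2) = 0 on X, then b vanishes on this line, so the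
    equation l of the line divides b. As l(F0, F1, F2) is not 0 on X, which is
    irreducible, the quotient of b by l has the same property, and b = 0 by
    induction on the degree.

    Degree (degree_two): let K be the pull-back by phi of the function field
    of the plane. For two well chosen linear forms l0 and l1 on the space, the
    ratio e = l1 / l0 satisfies an equation c2 e^2 + c1 e + c0 = 0 with
    coefficients in K. The discriminant c1^2 - 4 c0 c2 has odd degree in one
    of the coordinates of the plane, so it is not a square in K and e is not
    in K (odd_not_square). For each coordinate x of the space there is an
    equation x (a l0 + b l1) = p l0^2 + q l0 l1 + r l1^2 on X with
    coefficients in K, so the ratio x / l0 is in K(e). Hence the function
    field of X is K(e), of degree 2 over K.

    All the identities used are between polynomials with coefficients in the
    field with nine elements, modulo the equation of X. For each of the two
    triples of the statement they are collected in a certificate, and a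
    certificate is checked by computing normal forms of polynomial expressions
    (same_sound, certificate_sound). *)

Set Implicit Arguments.
Unset Strict Implicit.
Unset Printing Implicit Defensive.

Import GRing.Theory.
Local Open Scope ring_scope.

(** * Polynomial expressions over the field with nine elements *)

(** The prime field with three elements; the constructors stand for 0, 1
    and -1. *)
Inductive F3 := Z3 | P3 | N3.
Definition add3 a b := match a, b with
  | Z3, c | c, Z3 => c | P3, P3 => N3 | N3, N3 => P3 | _, _ => Z3 end.
Definition opp3 a := match a with Z3 => Z3 | P3 => N3 | N3 => P3 end.
Definition mul3 a b := match a, b with
  | Z3, _ | _, Z3 => Z3 | P3, c | c, P3 => c | N3, N3 => P3 end.
Definition eq3 a b := match a, b with
  | Z3, Z3 | P3, P3 | N3, N3 => true | _, _ => false end.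

(** The field with nine elements: the pair (a, b) stands for a + b i, where
    i is a square root of -1. *)
Definition F9 := (F3 * F3)%type.
Definition add9 (a b : F9) : F9 := (add3 a.1 b.1, add3 a.2 b.2).
Definition opp9 (a : F9) : F9 := (opp3 a.1, opp3 a.2).
Definition sub9 a b := add9 a (opp9 b).
Definition mul9 (a b : F9) : F9 :=
  (add3 (mul3 a.1 b.1) (opp3 (mul3 a.2 b.2)),
   add3 (mul3 a.1 b.2) (mul3 a.2 b.1)).
Definition eq9 (a b : F9) := eq3 a.1 b.1 && eq3 a.2 b.2.

(** Polynomial expressions with coefficients in the field with nine elements;
    the variables are numbered from 0. *)
Inductive expr :=
  | Cst of F9 | Var of nat | Add of expr & expr | Opp of expr
  | Mul of expr & expr | Exp of expr & nat.

Fixpoint to_PExpr e : PExpr F9 := match e with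
  | Cst c => PEc c
  | Var j => PEX _ (Pos.of_succ_nat j)
  | Add a b => PEadd (to_PExpr a) (to_PExpr b)
  | Opp a => PEopp (to_PExpr a)
  | Mul a b => PEmul (to_PExpr a) (to_PExpr b)
  | Exp a n => PEpow (to_PExpr a) (N.of_nat n)
  end.

Definition zero9 : F9 := (Z3, Z3).
Definition one9 : F9 := (P3, Z3).

(** Only the division by 1 is exact: rewriting rules are used with monic
    left-hand sides. *)
Definition div9 (a b : F9) : F9 * F9 :=
  if eq9 b one9 then (a, zero9) else (zero9, a).

(** The normal form of an expression, where each rule (monomial, expression)
    rewrites the multiples of its monomial. The number 100 bounds the number of
    rewriting passes. *)
Definition normal (rules : seq (expr * expr)) e :=
  norm_subst zero9 one9 add9 mul9 sub9 opp9 eq9 div9 100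
   (mk_monpol_list zero9 one9 add9 mul9 sub9 opp9 eq9 div9
      [seq (to_PExpr r.1, to_PExpr r.2) | r <- rules]) (to_PExpr e).

(** The normal forms are equal; this implies equality modulo the rules. *)
Definition same rules e1 e2 :=
  Ring_polynom.Peq eq9 (normal rules e1) (normal rules e2).

(** Substitution of the expressions s for the variables; a variable whose
    number is not below the size of s becomes 0. *)
Fixpoint subst (s : seq expr) e := match e with
  | Cst c => Cst c
  | Var j => nth (Cst zero9) s j
  | Add a b => Add (subst s a) (subst s b)
  | Opp a => Opp (subst s a)
  | Mul a b => Mul (subst s a) (subst s b)
  | Exp a n => Exp (subst s a) n
  end.

Section Evaluation.
Variables (R : comNzRingType) (iR : R).

Definition val3 a : R := match a with Z3 => 0 | P3 => 1 | N3 => -1 end.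
Definition val9 (c : F9) : R := val3 c.1 + val3 c.2 * iR.

Fixpoint eval (v : seq R) e : R := match e with
  | Cst c => val9 c
  | Var j => v`_j
  | Add a b => eval v a + eval v b
  | Opp a => - eval v a
  | Mul a b => eval v a * eval v b
  | Exp a n => eval v a ^+ n
  end.

(** The point v satisfies the equations expressed by the rules. *)
Fixpoint all_rules v (rules : seq (expr * expr)) : Prop :=
  if rules is r :: rules' then eval v r.1 = eval v r.2 /\ all_rules v rules'
  else True.

Lemma val9_0 : val9 zero9 = 0. Proof. by rewrite /val9 /= mul0r addr0. Qed.
Lemma val9_1 : val9 one9 = 1. Proof. by rewrite /val9 /= mul0r addr0. Qed.

Lemma eval_subst v s e :
  eval v (subst s e) = eval [seq eval v t | t <- s] e.
Proof.
elim: e => //= [j|a -> b ->|a ->|a -> b ->|a ->] //.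
have [lt_js|le_sj] := ltnP j (size s).
  by rewrite (nth_map (Cst zero9)).
by rewrite !nth_default ?size_map //= val9_0.
Qed.

Hypotheses (char3 : 3 \in [pchar R]) (i_sq : iR ^+ 2 = -1).

Let twoN : (1 + 1 : R) = -1.
Proof.
apply/eqP; rewrite -subr_eq0 opprK -addrA; apply/eqP.
by have := pcharf0 char3; rewrite !mulrS mulr0n addr0.
Qed.

Let oneN : (-1 - 1 : R) = 1.
Proof. by rewrite -opprD twoN opprK. Qed.

Lemma val3D a b : val3 (add3 a b) = val3 a + val3 b.
Proof.
by case: a b => [] [] //=; rewrite ?(addr0, add0r, twoN, oneN, addrN, addNr).
Qed.

Lemma val3N a : val3 (opp3 a) = - val3 a.
Proof. by case: a; rewrite /= ?oppr0 ?opprK. Qed.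

Lemma val3M a b : val3 (mul3 a b) = val3 a * val3 b.
Proof.
by case: a b => [] [] //=; rewrite ?(mulr0, mul0r, mulr1, mul1r, mulN1r, opprK).
Qed.

Lemma val9D a b : val9 (add9 a b) = val9 a + val9 b.
Proof. by rewrite /val9 /= !val3D; ring. Qed.

Lemma val9N a : val9 (opp9 a) = - val9 a.
Proof. by rewrite /val9 /= !val3N; ring. Qed.

Lemma val9M a b : val9 (mul9 a b) = val9 a * val9 b.
Proof.
rewrite /val9 /= !(val3D, val3N, val3M).
transitivity (val3 a.1 * val3 b.1 + val3 a.2 * val3 b.2 * iR ^+ 2
  + (val3 a.1 * val3 b.2 + val3 a.2 * val3 b.1) * iR); last by ring.
by rewrite i_sq; ring.
Qed.

Lemma eq3_eq a b : eq3 a b -> a = b.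
Proof. by case: a b => [] []. Qed.

Lemma eq9_eq a b : eq9 a b -> a = b.
Proof.
by case: a b => [a a'] [b b'] /andP[/= /eq3_eq -> /eq3_eq ->].
Qed.

Let Reqe : ring_eq_ext +%R *%R (-%R) (@eq R).
Proof. by split=> [? ? -> ? ? ->|? ? -> ? ? ->|? ? ->]. Qed.

Let Rth : ring_theory 0 1 +%R *%R (fun a b => a - b) (-%R) (@eq R).
Proof.
split=> // *; first [exact: add0r | exact: addrC | exact: addrA | exact: mul1r
  | exact: mulrC | exact: mulrA | exact: mulrDl | exact: addrN].
Qed.

Let Cth : ring_morph 0 1 +%R *%R (fun a b => a - b) (-%R) (@eq R)
  zero9 one9 add9 mul9 sub9 opp9 eq9 val9.
Proof.
split=> [|| a b | a b | a b | a | a b /eq9_eq -> //].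
- exact: val9_0.
- exact: val9_1.
- exact: val9D.
- by rewrite val9D val9N.
- exact: val9M.
- exact: val9N.
Qed.

Let Pth : power_theory 1 *%R (@eq R) N.to_nat (fun a n => a ^+ n).
Proof.
split=> a [|p] //=; elim: p => [p IHp|p IHp|] /=; last by rewrite expr1.
- by rewrite Pnat.Pos2Nat.inj_xI exprS multE mulnC exprM expr2 IHp.
- by rewrite Pnat.Pos2Nat.inj_xO multE mulnC exprM expr2 IHp.
Qed.

Let Dth : div_theory (@eq R) add9 mul9 val9 div9.
Proof.
split=> a b; rewrite /div9; case: ifP => [/eq9_eq -> | _].
  by rewrite val9D val9M val9_0 val9_1 mul1r addr0.
by rewrite val9D val9M val9_0 mulr0 add0r.
Qed.

Lemma nth_of_succ_nat j (v : seq R) :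
  BinList.nth 0 (Pos.of_succ_nat j) v = v`_j.
Proof.
rewrite -[v in LHS]/(List.tl (0 :: v)) BinList.nth_jump.
have ->: BinList.jump (Pos.of_succ_nat j) (0 :: v) = drop j v.
  elim: j => [|j IHj] /=; first by rewrite drop0.
  rewrite BinList.jump_succ IHj /= -add1n -drop_drop.
  by case: (drop j v) => //= ? ?; rewrite drop0.
transitivity (head 0 (drop j v)); first by case: (drop j v).
by rewrite -nth0 nth_drop addn0.
Qed.

Lemma eval_to_PExpr v e :
  eval v e = PEeval 0 1 +%R *%R (fun a b => a - b) (-%R) val9 N.to_nat
               (fun a n => a ^+ n) v (to_PExpr e).
Proof.
elim: e => //= [j|a -> b ->|a ->|a -> b ->|a -> n] //.
  by rewrite nth_of_succ_nat.
by rewrite Nnat.Nat2N.id.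
Qed.

(** Soundness of the computation of normal forms: this is the correctness of
    the reflexive ring normalisation, for the coefficient ring F9. *)
Lemma same_sound rules v e1 e2 :
  all_rules v rules -> same rules e1 e2 -> eval v e1 = eval v e2.
Proof.
move=> holds same12; rewrite !eval_to_PExpr.
apply: (ring_correct _ Reqe (Rth_ARth _ Reqe Rth) Cth Pth Dth) same12.
elim: rules holds => //= -[a b] rules IH [ab /IH].
by case: rules IH => [|r rules] _ /=; rewrite -!eval_to_PExpr.
Qed.

End Evaluation.

Section Morphism.
Variables (R S : comNzRingType) (f : {rmorphism R -> S}) (iR : R).

Lemma rmorph_val9 c : f (val9 iR c) = val9 (f iR) c.
Proof.
have f3 a : f (val3 R a) = val3 S a.
  by case: a; rewrite /= ?rmorphN ?rmorph1 ?rmorph0.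
by rewrite rmorphD rmorphM /= !f3.
Qed.

Lemma rmorph_eval v e : f (eval iR v e) = eval (f iR) [seq f t | t <- v] e.
Proof.
elim: e => /= [c|j|a <- b <-|a <-|a <- b <-|a <- n].
- exact: rmorph_val9.
- have [lt_jv|le_vj] := ltnP j (size v); first by rewrite (nth_map 0).
  by rewrite !nth_default ?size_map // rmorph0.
- exact: rmorphD.
- exact: rmorphN.
- exact: rmorphM.
- exact: rmorphXn.
Qed.

End Morphism.

Fixpoint exp9 (c : F9) n : F9 :=
  if n is n'.+1 then mul9 c (exp9 c n') else one9.

(** The value of an expression at a point with coordinates in F9. *)
Fixpoint eval9 (v : seq F9) e : F9 := match e with
  | Cst c => c
  | Var j => nth zero9 v j
  | Add a b => add9 (eval9 v a) (eval9 v b)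
  | Opp a => opp9 (eval9 v a)
  | Mul a b => mul9 (eval9 v a) (eval9 v b)
  | Exp a n => exp9 (eval9 v a) n
  end.

Section Points.
Variables (k : fieldType) (i : k).
Hypotheses (char3 : 3 \in [pchar k]) (i_sq : i ^+ 2 = -1).

Lemma eval_val9 v e :
  eval i [seq val9 i c | c <- v] e = val9 i (eval9 v e).
Proof.
elim: e => /= [c|j|a -> b ->|a ->|a -> b ->|a -> n] //.
- have [lt_jv|le_vj] := ltnP j (size v); first by rewrite (nth_map zero9).
  by rewrite !nth_default ?size_map // val9_0.
- by rewrite (val9D i char3).
- by rewrite val9N.
- by rewrite (val9M char3 i_sq).
elim: n => [|n IHn] /=; first by rewrite expr0 val9_1.
by rewrite exprS IHn (val9M char3 i_sq).
Qed.

Lemma val9_neq0 c : ~~ eq9 c zero9 -> val9 i c != 0.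
Proof.
apply: contraNneq => c0.
(* The norm of a nonzero element is 1 or -1. *)
have: val9 i (mul9 (c.1, opp3 c.2) c) = 0.
  by rewrite (val9M char3 i_sq) // c0 mulr0.
case: c {c0} => [[] []] //= /eqP; rewrite /val9 /=.
all: rewrite ?(mul0r, addr0, oppr_eq0, oner_eq0) //.
Qed.

End Points.

(** The degree of a homogeneous expression, and None when the summands of some
    sum have different degrees. *)
Fixpoint degree e : option nat := match e with
  | Cst _ => Some 0%N
  | Var _ => Some 1%N
  | Add a b => if degree a is Some m then
      if degree b is Some n then if m == n then Some m else None else None
      else None
  | Opp a => degree a
  | Mul a b => if degree a is Some m then
      if degree b is Some n then Some (m + n)%N else None else None
  | Exp a n => if degree a is Some m then Some (m * n)%N else None
  end.

Section Forms.
Variables (k : comNzRingType) (i : k) (n : nat).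

(** The polynomial in n variables denoted by an expression. *)
Definition poly_of e : {mpoly k[n]} :=
  eval i%:MP [seq 'X_j | j <- enum 'I_n] e.

Lemma poly_of_homog e d : degree e = Some d -> poly_of e \is d.-homog.
Proof.
rewrite /poly_of.
elim: e d => /= [c|j|a IHa b IHb|a IHa|a IHa b IHb|a IHa m] d.
- move=> [<-]; have -> : val9 (i%:MP : {mpoly k[n]}) c = (val9 i c)%:MP.
    by rewrite -(rmorph_val9 (@mpolyC n k)).
  by rewrite -[_%:MP]mulr1 mul_mpolyC; apply/dhomogZ/dhomog1.
- move=> [<-]; have [lt_jn|le_nj] := ltnP j n.
    by rewrite (nth_map (Ordinal lt_jn)) ?size_enum_ord // dhomogX /= mdeg1.
  by rewrite nth_default ?dhomog0 // size_map size_enum_ord.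
- case: (degree a) IHa => // m /(_ _ erefl) Ha.
  case: (degree b) IHb => // m' /(_ _ erefl) Hb.
  by case: eqP => // mm' [<-]; apply: dhomogD; rewrite // mm'.
- by move/IHa; rewrite -dhomogN.
- case: (degree a) IHa => // m /(_ _ erefl) Ha.
  case: (degree b) IHb => // m' /(_ _ erefl) Hb [<-].
  exact: dhomogM.
- case: (degree a) IHa => // m' /(_ _ erefl) Ha [<-].
  exact: dhomogMn.
Qed.

Lemma poly_of_rmorph (S : comNzRingType) (f : {rmorphism {mpoly k[n]} -> S}) e :
  f (poly_of e) = eval (f i%:MP) [seq f 'X_j | j <- enum 'I_n] e.
Proof. by rewrite rmorph_eval -map_comp. Qed.

Lemma poly_of_meval e v :
  (poly_of e).@[v] = eval i [seq v j | j <- enum 'I_n] e.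
Proof.
rewrite /poly_of (rmorph_eval (meval v)) /= mevalC -map_comp.
congr (eval _ _ _).
by apply: eq_map => j /=; rewrite mevalXU.
Qed.

End Forms.

(** * Polynomials over an algebraically closed field *)

Lemma rmorph_mmap n (R : nzRingType) (S T : comNzRingType)
    (h : {rmorphism R -> S}) (f : {rmorphism S -> T}) (g : 'I_n -> S) p :
  f (mmap h g p) = mmap (f \o h) (f \o g) p.
Proof.
rewrite /mmap rmorph_sum; apply: eq_bigr => m _.
rewrite rmorphM rmorph_prod; congr (_ * _).
by apply: eq_bigr => j _; rewrite rmorphXn.
Qed.

Lemma mmap_eq n (R S : nzRingType) (f : R -> S) (g h : 'I_n -> S) p :
  g =1 h -> mmap f g p = mmap f h p.
Proof. by move=> gh; apply: eq_bigr => m _; rewrite (mmap1_eq _ gh). Qed.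

Lemma mmap_homog n (R : nzRingType) (S : comNzRingType) (h : R -> S)
    (g : 'I_n -> S) (c : S) d p :
  p \is d.-homog -> mmap h (fun j => c * g j) p = c ^+ d * mmap h g p.
Proof.
move=> /dhomogP Hp; rewrite /mmap mulr_sumr big_seq [RHS]big_seq.
apply: eq_bigr => m /Hp <-; rewrite mulrCA; congr (_ * _).
rewrite /mmap1 /= mdegE -prodrXr -big_split /=.
by apply: eq_bigr => j _; rewrite exprMn.
Qed.

Lemma meval_homog n (R : comNzRingType) (p : {mpoly R[n]}) d c v :
  p \is d.-homog -> p.@[fun j => c * v j] = c ^+ d * p.@[v].
Proof. exact: mmap_homog. Qed.

Lemma poly_vanish (k : closedFieldType) (p : {poly k}) :
  (forall t, p.[t] = 0) -> p = 0.
Proof.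
move=> p0; apply/eqP/negPn/negP => /closed_nonrootP[t].
by rewrite /root p0 eqxx.
Qed.

Section LastVariable.
Variables (k : closedFieldType) (n : nat).

(* A polynomial in n + 1 variables is read as a univariate polynomial in the
   last variable, with coefficients in the polynomials in n variables. *)
Let ext (S : Type) (v : 'I_n -> S) (t : S) (j : 'I_n.+1) :=
  if unlift ord_max j is Some l then v l else t.

Let to_poly : {mpoly k[n.+1]} -> {poly {mpoly k[n]}} :=
  mmap (polyC \o @mpolyC n k) (ext (fun l => ('X_l)%:P) 'X).

Let to_poly_inj p : to_poly p = 0 -> p = 0.
Proof.
pose widen : {rmorphism {mpoly k[n]} -> {mpoly k[n.+1]}} :=
  mmap (@mpolyC n.+1 k) (fun l => 'X_(lift ord_max l)).
pose back : {rmorphism {poly {mpoly k[n]}} -> {mpoly k[n.+1]}} :=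
  horner_eval 'X_ord_max \o map_poly widen.
move=> p0; have: back (to_poly p) = 0 by rewrite p0 rmorph0.
rewrite rmorph_mmap.
have -> : mmap (back \o (polyC \o @mpolyC n k))
    (back \o ext (fun l => ('X_l)%:P) 'X) p = p; last by [].
rewrite -[RHS]comp_mpoly_id /comp_mpoly /mmap; apply: eq_bigr => m _.
rewrite /= map_polyC horner_evalE hornerC /= mmapC; congr (_ * _).
apply: mmap1_eq => j; rewrite tnth_mktuple /= /ext.
case: unliftP => [l|] -> /=.
  by rewrite map_polyC horner_evalE hornerC /= mmapX mmap1U.
by rewrite map_polyX horner_evalE hornerX.
Qed.

Let to_polyE p v t : (map_poly (meval v) (to_poly p)).[t] = p.@[ext v t].
Proof.
pose f : {rmorphism {poly {mpoly k[n]}} -> k} :=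
  horner_eval t \o map_poly (meval v).
rewrite -[LHS]/(f (to_poly p)) rmorph_mmap /meval /mmap.
apply: eq_bigr => m _.
rewrite /= map_polyC horner_evalE hornerC /= mevalC; congr (_ * _).
apply: mmap1_eq => j /=; rewrite /ext.
case: unliftP => [l|] eq_j /=.
  by rewrite map_polyC horner_evalE hornerC /= mevalXU.
by rewrite map_polyX horner_evalE hornerX.
Qed.

Lemma mpoly_vanish_step :
  (forall q : {mpoly k[n]}, (forall v, q.@[v] = 0) -> q = 0) ->
  forall p : {mpoly k[n.+1]}, (forall v, p.@[v] = 0) -> p = 0.
Proof.
move=> IH p p0; apply: to_poly_inj; apply/polyP => j; rewrite coef0.
apply: IH => v.
have p_v0 : map_poly (meval v) (to_poly p) = 0.
  by apply: poly_vanish => t; rewrite to_polyE.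
by have := congr1 (coefp j) p_v0; rewrite /= coef_map coef0.
Qed.

End LastVariable.

Lemma mpoly_vanish (k : closedFieldType) n (p : {mpoly k[n]}) :
  (forall v, p.@[v] = 0) -> p = 0.
Proof.
elim: n p => [|n IHn] p p0; last exact: mpoly_vanish_step p0.
have := p0 (fun=> 0); rewrite [p]nvar0_mpolyC.
by rewrite mevalC => ->; rewrite mpolyC0.
Qed.

Section Parity.
Variables (k : closedFieldType) (n : nat).

(** The restriction of a polynomial to the parametrised line v + t q, as a
    polynomial in t. *)
Definition along (v q : 'I_n -> k) : {mpoly k[n]} -> {poly k} :=
  mmap (@polyC k) (fun j => (v j)%:P + q j *: 'X).

HB.instance Definition _ v q := GRing.RMorphism.copy (along v q)
  (mmap (@polyC k) (fun j => (v j)%:P + q j *: 'X)).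

Lemma along0 v q p : (along v q p).[0] = p.@[v].
Proof.
rewrite -[LHS]/(horner_eval 0 (along v q p)) /along rmorph_mmap /meval /mmap.
apply: eq_bigr => m _; rewrite /= horner_evalE hornerC; congr (_ * _).
apply: mmap1_eq => j /=.
by rewrite horner_evalE hornerD hornerC hornerZ hornerX mulr0 addr0.
Qed.

(** A polynomial D that has odd degree on the general line of direction q is
    not a square, even up to a square factor: on such a line A ^+ 2 and D * B
    ^+ 2 have degrees of different parities. The general lines are those
    through the points where d is not zero. *)
Lemma odd_not_square (D A B d : {mpoly k[n]}) q :
    d != 0 ->
    (forall v, d.@[v] != 0 -> odd (size (along v q D)).-1) ->
  A ^+ 2 = D * B ^+ 2 -> B = 0.
Proof.
move=> d_neq0 oddD AB; have: d * B = 0.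
  apply: mpoly_vanish => v; rewrite mevalM.
  have [->|dv] := eqVneq d.@[v] 0; first by rewrite mul0r.
  have := oddD v dv; rewrite -(along0 v q B) => {oddD}.
  have [->|b_neq0] := eqVneq (along v q B) 0; first by rewrite horner0 mulr0.
  have: along v q A ^+ 2 = along v q D * along v q B ^+ 2.
    by rewrite -!rmorphXn -rmorphM AB.
  move: b_neq0; move: (along v q A) (along v q B) (along v q D) => a b e b0.
  have [->|e0] := eqVneq e 0; first by rewrite size_poly0.
  have [->|a0] := eqVneq a 0.
    rewrite expr0n /= => /esym/eqP.
    by rewrite mulf_eq0 expf_eq0 /= (negPf e0) (negPf b0).
  move/(congr1 (fun p : {poly k} => size p)).
  rewrite !expr2 !size_mul ?mulf_neq0 //.
  move: a0 b0 e0; rewrite -!size_poly_gt0.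
  case: (size a) (size b) (size e) => [|x] [|y] [|z] //= _ _ _.
  rewrite !addnS !addnn /= => /(congr1 odd).
  by rewrite !(oddD, odd_double, oddS); case: (odd z).
by move/eqP; rewrite mulf_eq0 (negPf d_neq0) => /eqP.
Qed.

End Parity.

(** * Irreducibility of the Fermat quartic surface *)

Section FermatQuartic.
Variables (k : closedFieldType) (i : k).
Hypotheses (char3 : 3 \in [pchar k]) (i_sq : i ^+ 2 = -1).

Let three0 : 1 + 1 + 1 = 0 :> k.
Proof. by have := pcharf0 char3; rewrite !mulrS mulr0n addr0 addrA. Qed.

(** The sum of the fourth powers of three variables. *)
Definition ternary_fermat : {mpoly k[3]} := \sum_(j < 3) 'X_j ^+ 4.
Let g := ternary_fermat.

Let g_eval v : g.@[v] = v 0 ^+ 4 + v 1 ^+ 4 + v 2%:R ^+ 4.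
Proof.
rewrite /g /ternary_fermat !big_ord_recl big_ord0 addr0 !mevalD !rmorphXn /=.
rewrite !mevalXU addrA.
by congr (v _ ^+ 4 + v _ ^+ 4 + v _ ^+ 4); apply: val_inj.
Qed.

(** When a ^+ 4 = -1, the direction (a, 1, 0) is a zero of the form, so that on
    the lines of this direction the form has degree 3 instead of 4. *)
Lemma ternary_fermat_not_square c A B :
  c != 0 -> A ^+ 2 = (c *: g) * B ^+ 2 -> B = 0.
Proof.
have [a a4] : exists a : k, a ^+ 4 + 1 = 0.
  exists (1 + i).
  transitivity ((i ^+ 2 + 1) * (i ^+ 2 + 4 * i + 5) + (1 + 1 + 1) * (-1)).
    by ring.
  by rewrite i_sq three0; ring.
move=> c_neq0; pose q (j : 'I_3) := if j == 0 then a else (j == 1)%:R.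
apply: (@odd_not_square _ _ _ _ _ ((a ^+ 3) *: 'X_0 + 'X_1) q) => [|v].
  apply: contraTneq (oner_neq0 k) => /(congr1 (meval (fun j => (j == 1)%:R))).
  rewrite mevalD mevalZ !mevalXU meval0 /= mulr0 add0r => /eqP.
  by rewrite oner_eq0.
rewrite mevalD mevalZ !mevalXU => dv.
have -> : along v q (c *: g) = c *: ((a ^+ 3 * v 0 + v 1) *: 'X ^+ 3
   + ((a * v 0 ^+ 3 + v 1 ^+ 3) *: 'X
      + (v 0 ^+ 4 + v 1 ^+ 4 + v 2%:R ^+ 4)%:P)).
  rewrite /along mmapZ mul_polyC /g /ternary_fermat.
  rewrite !big_ord_recl big_ord0 addr0.
  rewrite !rmorphD !rmorphXn /= !mmapX !mmap1U /q /=.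
  have -> : lift ord0 ord0 = 1 :> 'I_3 by exact: val_inj.
  have -> : lift ord0 (lift ord0 ord0) = 2%:R :> 'I_3 by exact: val_inj.
  rewrite -[ord0]/(0 : 'I_3) -!mul_polyC !(polyCD, polyCM, rmorphXn) /=.
  have a4P : a%:P ^+ 4 + 1 = 0 :> {poly k} by rewrite -rmorphXn -polyCD a4.
  have threeP : 1 + 1 + 1 = 0 :> {poly k} by rewrite -!polyCD three0.
  move: (v 0)%:P (v 1)%:P (v 2%:R)%:P (a%:P) 'X a4P => x y z b t b4.
  congr (_ * _); rewrite polyC1 polyC0 mul1r mul0r addr0.
  (* The two sides differ by a multiple of 3 and of b ^+ 4 + 1. *)
  set r := RHS; transitivity (r + (b ^+ 4 + 1) * t ^+ 4
    + (1 + 1 + 1) * (x ^+ 3 * b * t + 2 * x ^+ 2 * b ^+ 2 * t ^+ 2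
      + x * b ^+ 3 * t ^+ 3 + y ^+ 3 * t + 2 * y ^+ 2 * t ^+ 2 + y * t ^+ 3)).
    by rewrite /r; ring.
  by rewrite b4 threeP !mul0r !addr0.
have small : leq (size ((a * v 0 ^+ 3 + v 1 ^+ 3) *: 'X
    + (v 0 ^+ 4 + v 1 ^+ 4 + v 2%:R ^+ 4)%:P)) 3.
  rewrite -mul_polyC size_MXaddC; case: ifP => // _.
  by rewrite (leq_ltn_trans (size_polyC_leq1 _)).
by rewrite size_scale // size_polyDl size_scale // size_polyXn.
Qed.

(* For z with z ^+ 4 = - g, the norm over the base field k(w, x, y) of
   r 0 + r 1 z + r 2 z^2 + r 3 z^3 is A ^+ 2 + g B ^+ 2, where A + B z^2 is the
   norm to the intermediate field generated by z^2. *)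
Section Norm.
Variable r : 'I_4 -> {mpoly k[3]}.

Let A := r 0 ^+ 2 - g * r 2%:R ^+ 2 + 2%:R * g * r 1 * r 3%:R.
Let B := 2%:R * r 0 * r 2%:R - r 1 ^+ 2 + g * r 3%:R ^+ 2.

(** An element of norm 0 is 0, since neither g nor - g is a square. *)
Lemma fermat_norm_eq0 : A ^+ 2 + g * B ^+ 2 = 0 -> forall j, r j = 0.
Proof.
have parity A' B' : A' ^+ 2 = g * B' ^+ 2 -> B' = 0.
  move=> e; apply: (@ternary_fermat_not_square 1 A' B'); rewrite ?oner_neq0 //.
  by rewrite scale1r.
have parityN A' B' : A' ^+ 2 = - (g * B' ^+ 2) -> B' = 0.
  move=> e; apply: (@ternary_fermat_not_square (-1) A' B').
    by rewrite oppr_eq0 oner_neq0.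
  by rewrite scaleN1r mulNr.
have two0 A' B' : A' ^+ 2 + g * B' ^+ 2 = 0 -> A' = 0 /\ B' = 0.
  move/eqP; rewrite addr_eq0 => /eqP e; have B0 := parityN _ _ e.
  by move/eqP: e; rewrite B0 expr0n mulr0 oppr0 expf_eq0 => /eqP.
case/two0 => A0 B0.
have : (r 0 ^+ 2 + g * r 2%:R ^+ 2) ^+ 2
    = g * (r 1 ^+ 2 + g * r 3%:R ^+ 2) ^+ 2.
  transitivity ((A - 2%:R * g * r 1 * r 3%:R) ^+ 2
    + g * (B + r 1 ^+ 2 - g * r 3%:R ^+ 2) ^+ 2); first by rewrite /A /B; ring.
  by rewrite A0 B0; ring.
move=> e; have b0 := parity _ _ e; have [r1 r3] := two0 _ _ b0.
move/eqP: e; rewrite b0 expr0n mulr0 expf_eq0 /= => /eqP/two0[r0 r2].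
by case=> [[|[|[|[|j]]]] lt_j] //; [rewrite -[RHS]r0|rewrite -[RHS]r1
  |rewrite -[RHS]r2|rewrite -[RHS]r3]; congr r; apply: val_inj.
Qed.
End Norm.

(** The affine cone over the Fermat quartic surface. *)
Definition cone (v : 'I_4 -> k) := \sum_j v j ^+ 4 = 0.

Let base (v : 'I_4 -> k) : 'I_3 -> k := fun l => v (lift ord_max l).

Let coneE v : cone v -> v ord_max ^+ 4 = - g.@[base v].
Proof.
rewrite /cone big_ord_recr /= g_eval !big_ord_recl big_ord0 addr0 addrA addrC.
move=> e; apply/eqP; rewrite -addr_eq0; apply/eqP; rewrite -[RHS]e.
by congr (_ + (v _ ^+ 4 + v _ ^+ 4 + v _ ^+ 4)); apply: val_inj.
Qed.

(** On the cone, every polynomial is a polynomial of degree at most 3 in the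
    last coordinate. *)
Lemma fermat_reduce (p : {mpoly k[4]}) :
  exists r : 'I_4 -> {mpoly k[3]}, forall v, cone v ->
    p.@[v] = \sum_j (r j).@[base v] * v ord_max ^+ j.
Proof.
elim/mpolyind: p => [|c m p _ _ [r rP]].
  exists (fun=> 0) => v _; rewrite meval0 big1 // => j _.
  by rewrite meval0 mul0r.
pose s := (m ord_max %% 4)%N; pose q := (m ord_max %/ 4)%N.
have lt_s4 : (s < 4)%N by rewrite ltn_mod.
pose t := c *: (\prod_l 'X_l ^+ m (lift ord_max l)) * (- g) ^+ q.
exists (fun j => (if j == Ordinal lt_s4 then t else 0) + r j) => v cv.
rewrite mevalD rP //; under [in RHS]eq_bigr do rewrite mevalD mulrDl.
rewrite big_split /=; congr (_ + _).
rewrite (bigD1 (Ordinal lt_s4)) //= eqxx.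
rewrite big1 ?addr0 => [|j /negPf->]; last first.
  by rewrite meval0 mul0r.
rewrite mevalZ mevalX mevalM mevalZ rmorphXn rmorphN rmorph_prod /= -coneE //.
rewrite -exprM -!mulrA -exprD mulnC -divn_eq; congr (_ * _).
rewrite (bigD1_ord ord_max) //= mulrC; congr (_ * _).
by apply: eq_bigr => l _; rewrite rmorphXn /= mevalXU.
Qed.

(** A polynomial p has a norm N, a polynomial in the first three coordinates:
    N is zero only if p vanishes on the cone, and N vanishes wherever p does. *)
Lemma fermat_norm (p : {mpoly k[4]}) :
  exists N : {mpoly k[3]},
    (N = 0 -> forall v, cone v -> p.@[v] = 0) /\
    (forall v, cone v -> p.@[v] = 0 -> N.@[base v] = 0).
Proof.
have [r rP] := fermat_reduce p.
pose A := r 0 ^+ 2 - g * r 2%:R ^+ 2 + 2%:R * g * r 1 * r 3%:R.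
pose B := 2%:R * r 0 * r 2%:R - r 1 ^+ 2 + g * r 3%:R ^+ 2.
exists (A ^+ 2 + g * B ^+ 2); split=> [/fermat_norm_eq0 r0 v cv | v cv].
  by rewrite rP // big1 // => j _; rewrite r0 meval0 mul0r.
rewrite rP // !big_ord_recl big_ord0 addr0.
have -> : lift ord0 ord0 = 1 :> 'I_4 by exact: val_inj.
have -> : lift ord0 (lift ord0 ord0) = 2%:R :> 'I_4 by exact: val_inj.
have -> : lift ord0 (lift ord0 (lift ord0 ord0)) = 3%:R :> 'I_4.
  exact: val_inj.
rewrite /A /B !(mevalD, mevalM, mevalN, rmorphXn, rmorph_nat) /=.
have := coneE cv; move: (g.@[_]) (v ord_max) => G z z4.
rewrite -[ord0]/(0 : 'I_4).
move: (r 0).@[_] (r 1).@[_] (r 2%:R).@[_] (r 3%:R).@[_] => a b c d p0.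
have -> : G = - z ^+ 4 by rewrite z4 opprK.
set N := (X in X = 0).
transitivity ((a * z ^+ 0 + (b * z ^+ 1 + (c * z ^+ 2 + d * z ^+ 3)))
  * ((a - b * z + c * z ^+ 2 - d * z ^+ 3)
     * (a ^+ 2 + z ^+ 4 * c ^+ 2 - 2%:R * z ^+ 4 * b * d
        - (2%:R * a * c - b ^+ 2 - z ^+ 4 * d ^+ 2) * z ^+ 2))).
  by rewrite /N; ring.
by rewrite [X in X * _]p0 mul0r.
Qed.

Lemma cone_base (u : 'I_3 -> k) : exists2 v, cone v & base v =1 u.
Proof.
have [z z4] : exists z, z ^+ 4 = - g.@[u].
  have [z] :=
    @solve_monicpoly k 4 (fun j => if j == 0%N then - g.@[u] else 0) isT.
  rewrite big_ord_recl big1 => [|j _]; last by rewrite mul0r.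
  by rewrite expr0 mulr1 addr0; exists z.
pose v j := if unlift ord_max j is Some l then u l else z.
have bv : base v =1 u by move=> l; rewrite /base /v liftK.
exists v => //; rewrite /cone big_ord_recr /= [v ord_max]/v unlift_none z4.
have -> : \sum_(j < 3) v (widen_ord (leqnSn 3) j) ^+ 4 = g.@[u].
  rewrite /g /ternary_fermat rmorph_sum; apply: eq_bigr => j _.
  rewrite rmorphXn /= mevalXU -bv; congr (v _ ^+ 4).
  by apply: val_inj; rewrite /= /bump leqNgt ltn_ord.
by rewrite subrr.
Qed.

Lemma cone_prime (p q : {mpoly k[4]}) :
  (forall v, cone v -> (p * q).@[v] = 0) ->
  (forall v, cone v -> p.@[v] = 0) \/ (forall v, cone v -> q.@[v] = 0).
Proof.
have [[N [N0 Np]] [M [M0 Mq]]] := (fermat_norm p, fermat_norm q).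
move=> pq0; have /eqP : N * M = 0.
  apply: mpoly_vanish => u; have [v cv bv] := cone_base u.
  rewrite mevalM -!(meval_eq _ bv).
  have /eqP := pq0 v cv; rewrite mevalM mulf_eq0 => /orP[]/eqP.
    by move=> /(Np v cv) ->; rewrite mul0r.
  by move=> /(Mq v cv) ->; rewrite mulr0.
by rewrite mulf_eq0 => /orP[] /eqP; [left; apply: N0 | right; apply: M0].
Qed.

End FermatQuartic.

(** * Morphisms given by several tuples of forms *)

Section ProjectivePoints.
Variables (k : closedFieldType) (n : nat).

Lemma dim_line (v : 'rV[k]_n.+1) : v != 0 -> \dim <[v]>%VS == 1%N.
Proof. by move=> v0; rewrite dim_vline v0. Qed.

(** The point of the projective space with homogeneous coordinates v. *)
Definition point (v : 'rV[k]_n.+1) (v0 : v != 0) : proj k n :=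
  exist _ <[v]>%VS (dim_line v0).

Lemma proj_rep (P : proj k n) : exists2 v, v != 0 & val P = <[v]>%VS.
Proof.
case: P => L /= dL; exists (vpick L).
  by rewrite vpick0 -dimv_eq0 (eqP dL).
apply/esym/eqP; rewrite eqEdim (eqP dL) dim_vline vpick0 -dimv_eq0 (eqP dL) /=.
by rewrite -memvE memv_pick.
Qed.

Lemma proj_line (P : proj k n) v : v \in val P -> v != 0 -> val P = <[v]>%VS.
Proof.
case: P => L /= dL vL v0; apply/esym/eqP.
by rewrite eqEdim (eqP dL) dim_vline v0 -memvE vL.
Qed.

Lemma vanishes_homog (p : {mpoly k[n.+1]}) d (P : proj k n) v :
  p \is d.-homog -> v \in val P -> v != 0 ->
  vanishes_at p P <-> p.@[v 0] = 0.
Proof.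
move=> hp vP v0; split=> [|p0 u]; first exact.
rewrite (proj_line vP v0) => /vlineP[c ->].
rewrite (@meval_eq _ _ _ (fun j => c * v 0 j)) => [|j]; last by rewrite mxE.
by rewrite (meval_homog _ _ hp) p0 mulr0.
Qed.

End ProjectivePoints.

Section Representatives.
Variables (k : closedFieldType) (n m : nat) (V : proj k n -> Prop).
Variable irr : irreducible_set V.
Notation poly := {mpoly k[n.+1]}.
Notation I := (in_ideal V).

Lemma in_idealP (p : poly) :
  reflect (forall P, V P -> vanishes_at p P) (p \in I).
Proof. exact: asboolP. Qed.

Lemma ideal_prime (p q : poly) : p * q \in I -> (p \in I) || (q \in I).
Proof. exact: irr.2. Qed.

(** F and G are proportional on V: their two-by-two minors vanish on V. *)
Definition proportional (F G : m.+1.-tuple poly) :=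
  forall j l, tnth F j * tnth G l - tnth F l * tnth G j \in I.

Lemma idealM (a p : poly) : p \in I -> a * p \in I.
Proof.
move/in_idealP=> p0; apply/in_idealP => P VP v vP.
by rewrite mevalM (p0 P VP v vP) mulr0.
Qed.

Lemma idealB (p q : poly) : p \in I -> q \in I -> p - q \in I.
Proof.
move/in_idealP=> p0 /in_idealP q0; apply/in_idealP => P VP v vP.
by rewrite mevalB (p0 P VP v vP) (q0 P VP v vP) subr0.
Qed.

Lemma proportional_trans F G H j0 :
  tnth F j0 \notin I -> proportional F G -> proportional F H ->
  proportional G H.
Proof.
move=> F0 FG FH j l.
suff : tnth F j0 * (tnth F j0 *
    (tnth G j * tnth H l - tnth G l * tnth H j)) \in I.
  move/ideal_prime; rewrite (negPf F0) => /ideal_prime.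
  by rewrite (negPf F0).
have -> : tnth F j0 * (tnth F j0 *
    (tnth G j * tnth H l - tnth G l * tnth H j)) =
  (tnth F j0 * tnth H l * (tnth F j0 * tnth G j - tnth F j * tnth G j0)
  - tnth F j0 * tnth H j * (tnth F j0 * tnth G l - tnth F l * tnth G j0))
  - (tnth G j0 * tnth F l * (tnth F j0 * tnth H j - tnth F j * tnth H j0)
  - tnth G j0 * tnth F j * (tnth F j0 * tnth H l - tnth F l * tnth H j0)).
  by ring.
by rewrite !idealB // idealM.
Qed.

(** The values of the forms G at v. *)
Definition values (G : m.+1.-tuple poly) (v : 'rV[k]_n.+1) : 'rV[k]_m.+1 :=
  \row_j (tnth G j).@[v 0].

Lemma values_neq0 G v : values G v != 0 -> exists j, (tnth G j).@[v 0] != 0.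
Proof.
move=> Gv; apply/existsP; apply: contraNT Gv.
rewrite negb_exists => /forallP G0.
by apply/eqP/rowP => j; rewrite !mxE; apply/eqP; have := G0 j; rewrite negbK.
Qed.

Lemma proportional_values G H (P : {P | V P}) v :
    proportional G H -> v \in val (sval P) ->
  values G v != 0 -> values H v != 0 ->
  <[values G v]>%VS = <[values H v]>%VS.
Proof.
move=> GH vP G0 H0.
have [j Gj] := values_neq0 G0.
have cross l : (tnth G j).@[v 0] * (tnth H l).@[v 0]
    = (tnth G l).@[v 0] * (tnth H j).@[v 0].
  have /in_idealP/(_ (sval P) (svalP P) v vP) := GH j l.
  by rewrite mevalB !mevalM => /eqP; rewrite subr_eq0 => /eqP.
have eH : values H v = ((tnth H j).@[v 0] / (tnth G j).@[v 0]) *: values G v.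
  apply/rowP => l; rewrite !mxE mulrAC; apply: (mulIf Gj).
  by rewrite mulfVK // mulrC cross mulrC.
apply/eqP; rewrite eq_sym eqEdim !dim_vline G0 H0 andbT.
by rewrite eH -memvE memvZ // memv_line.
Qed.

(** Several tuples of forms, all proportional on V to a given one and without
    common zero on V, define together a morphism on V: at each point, the
    values of any tuple that does not vanish there give the same point. *)
Lemma morphism_of_representatives (reps : seq (m.+1.-tuple poly)) F j0 :
    tnth F j0 \notin I ->
    {in reps, forall G, proportional F G} ->
    {in reps, forall G, exists d, forall j, tnth G j \is d.-homog} ->
    (forall P v, V P -> v \in val P -> v != 0 ->
       exists2 G, G \in reps & values G v != 0) ->
  exists phi : {P | V P} -> proj k m, is_morphism phi /\
    {in reps, forall G j, given_by phi (tnth G j) G}.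
Proof.
move=> F0 prop hom cover.
have ex (P : {P | V P}) : exists Q : proj k m, {in reps, forall G v,
    v \in val (sval P) -> v != 0 -> values G v != 0 ->
    val Q = <[values G v]>%VS}.
  have [v v0 eP] := proj_rep (sval P).
  have vP : v \in val (sval P) by rewrite eP memv_line.
  have [G Gr Gv] := cover _ v (svalP P) vP v0.
  exists (point Gv) => H Hr u uP u0 Hu /=.
  have /vlineP[c eu] : u \in <[v]>%VS by rewrite -eP.
  have c0 : c != 0 by apply: contraNneq u0 => c0; rewrite eu c0 scale0r.
  have [d hH] := hom H Hr.
  have eH : values H u = c ^+ d *: values H v.
    apply/rowP => j; rewrite !mxE eu -(meval_homog _ _ (hH j)).
    by apply: meval_eq => l; rewrite !mxE.
  have Hv : values H v != 0.
    by apply: contraNneq Hu => Hv; rewrite eH Hv scaler0.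
  rewrite (@proportional_values G H P v) //; last first.
    exact: (proportional_trans F0 (prop G Gr) (prop H Hr)).
  apply/eqP; rewrite eq_sym eqEdim !dim_vline Hu Hv andbT.
  by rewrite eH -memvE memvZ // memv_line.
have [phi phiP] := choice ex.
exists phi.
have given : {in reps, forall G j, given_by phi (tnth G j) G}.
  move=> G Gr j; have [d hG] := hom G Gr; split; [by exists d | by exists d |].
  move=> P nz v vP v0; apply: phiP => //.
  apply: contra_not_neq nz => Gv; apply/(vanishes_homog (hG j) vP v0).
  by have /rowP/(_ j) := Gv; rewrite !mxE.
split=> // P; have [v v0 eP] := proj_rep (sval P).
have vP : v \in val (sval P) by rewrite eP memv_line.
have [G Gr Gv] := cover _ v (svalP P) vP v0.
have [j Gj] := values_neq0 Gv.
exists (tnth G j), G; split; first exact: given.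
have [d hG] := hom G Gr.
by move/(vanishes_homog (hG j) vP v0)/eqP; rewrite (negPf Gj).
Qed.

End Representatives.

(** * Quadratic field extensions *)

Section QuadraticExtension.
Variables (Omega : fieldType) (K : Omega -> Prop).
Hypotheses (K1 : K 1) (KB : forall x y, K x -> K y -> K (x - y))
  (KM : forall x y, K x -> K y -> K (x * y)) (KV : forall x, K x -> K x^-1).
Variables (e t n : Omega).
Hypotheses (Kt : K t) (Kn : K n) (e_sq : e ^+ 2 = t * e + n) (Ke : ~ K e).

Let K0 : K 0. Proof. by rewrite -(subrr 1); apply: KB. Qed.
Let KN x : K x -> K (- x). Proof. by rewrite -sub0r; apply: KB. Qed.
Let KD x y : K x -> K y -> K (x + y).
Proof. by move=> Kx Ky; rewrite -(opprK y); apply/KB/KN. Qed.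

(** K + K e, which is the field K(e) when e is quadratic over K. *)
Definition adjoin (x : Omega) : Prop :=
  exists p q, [/\ K p, K q & x = p + q * e].

Lemma adjoin_base x : K x -> adjoin x.
Proof. by move=> Kx; exists x, 0; rewrite mul0r addr0. Qed.

Lemma adjoin_gen : adjoin e.
Proof. by exists 0, 1; rewrite mul1r add0r. Qed.

Lemma adjoin_free p q : K p -> K q -> p + q * e = 0 -> p = 0 /\ q = 0.
Proof.
move=> Kp Kq pq0; have [q0|q_neq0] := eqVneq q 0.
  by move: pq0; rewrite q0 mul0r addr0.
case: Ke; have -> : e = (- p) * q^-1.
  apply: (mulIf q_neq0); rewrite mulfVK // mulrC.
  by apply/eqP; rewrite -addr_eq0 addrC pq0.
by apply: KM; [apply: KN | apply: KV].
Qed.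

Lemma adjoinD x y : adjoin x -> adjoin y -> adjoin (x + y).
Proof.
move=> [p [q [Kp Kq ->]]] [p' [q' [Kp' Kq' ->]]].
by exists (p + p'), (q + q'); split; [apply: KD | apply: KD | ring].
Qed.

Lemma adjoinM x y : adjoin x -> adjoin y -> adjoin (x * y).
Proof.
move=> [p [q [Kp Kq ->]]] [p' [q' [Kp' Kq' ->]]].
exists (p * p' + q * q' * n), (p * q' + q * p' + q * q' * t); split.
- by apply: KD; apply: KM => //; apply: KM.
- by do 2?apply: KD; apply: KM => //; apply: KM.
transitivity (p * p' + (p * q' + q * p') * e + q * q' * e ^+ 2); first by ring.
by rewrite e_sq; ring.
Qed.

(** The inverse of p + q e is its conjugate p + q t - q e divided by the norm. *)
Lemma adjoinV x : adjoin x -> adjoin x^-1.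
Proof.
move=> [p [q [Kp Kq ex]]]; have [->|x_neq0] := eqVneq x 0.
  by rewrite invr0; apply: adjoin_base.
pose N := p * (p + q * t) - q * q * n.
have KN' : K N by apply: KB; [apply/KM/KD/KM | apply/KM => //; apply: KM].
have eN : x * (p + q * t - q * e) = N.
  transitivity (p ^+ 2 + p * q * t + q ^+ 2 * (t * e - e ^+ 2)).
    by rewrite ex; ring.
  by rewrite e_sq /N; ring.
have N_neq0 : N != 0.
  apply: contra_neq x_neq0 => N0; move: eN; rewrite N0 => /eqP.
  rewrite mulf_eq0 => /orP[/eqP //|/eqP conj0].
  have [|||p0 q0] := @adjoin_free (p + q * t) (- q).
  - by apply/KD/KM.
  - exact: KN.
  - by rewrite mulNr.
  move: p0 q0 => /eqP + /eqP; rewrite oppr_eq0 => + /eqP q0.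
  by rewrite ex q0 !mul0r !addr0 => /eqP.
have -> : x^-1 = N^-1 * (p + q * t - q * e).
  by apply: (mulfI x_neq0); rewrite mulfV // mulrCA eN mulVf.
exists (N^-1 * (p + q * t)), (N^-1 * - q); split; last by ring.
- by apply/KM; [apply: KV | apply/KD/KM].
- by apply/KM; [apply: KV | apply: KN].
Qed.

Lemma adjoin_prod (I : Type) (s : seq I) (f : I -> Omega) :
  (forall j, adjoin (f j)) -> adjoin (\prod_(j <- s) f j).
Proof.
move=> fL; elim/big_rec: _ => [|j x _]; [exact: adjoin_base | exact: adjoinM].
Qed.

Lemma extension_degree_two (E : Omega -> Prop) :
  E 1 -> E e -> (forall x, E x -> adjoin x) -> extension_degree E K 2.
Proof.
move=> E1 Ee EL; exists (fun j => if j == 0 then 1 else e).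
split=> [j|x /EL[p [q [Kp Kq ->]]]]; first by case: ifP.
exists [ffun j => if j == 0 then p else q]; split.
  split=> [j|]; first by rewrite ffunE; case: ifP.
  by rewrite !big_ord_recl big_ord0 !ffunE /= mulr1 addr0.
move=> c [Kc]; rewrite !big_ord_recl big_ord0 /= mulr1 addr0 => ec.
have [|||/eqP + /eqP] := @adjoin_free (c ord0 - p) (c (lift ord0 ord0) - q).
- exact: KB.
- exact: KB.
- by rewrite mulrBl addrACA -opprD -ec subrr.
rewrite !subr_eq0 => /eqP c0 /eqP c1; apply/ffunP => j; rewrite ffunE.
by case: (unliftP ord0 j) => [l|] -> /=; rewrite ?(ord1 l) ?c0 ?c1.
Qed.

End QuadraticExtension.

(** * The pull-back of the function field of the target *)

Section Fractions.
Local Open Scope quotient_scope.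
Variables (k : closedFieldType) (n : nat) (V : proj k n -> Prop).
Variable irr : irreducible_set V.
Notation poly := {mpoly k[n.+1]}.
Notation I := (in_ideal V).
Notation Omega := {fraction (coord_ring irr)}.

Lemma to_frac_is_zmod_morphism : zmod_morphism (to_frac irr).
Proof. by move=> p q; rewrite /to_frac !rmorphB. Qed.
Lemma to_frac_is_monoid_morphism : monoid_morphism (to_frac irr).
Proof. by split=> [|p q]; rewrite /to_frac ?rmorph1 // !rmorphM. Qed.
HB.instance Definition _ := GRing.isZmodMorphism.Build poly Omega
  (to_frac irr) to_frac_is_zmod_morphism.
HB.instance Definition _ := GRing.isMonoidMorphism.Build poly Omega
  (to_frac irr) to_frac_is_monoid_morphism.

Lemma to_frac_eq0 p : (to_frac irr p == 0) = (p \in I).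
Proof.
rewrite /to_frac tofrac_eq0 -[p in RHS]subr0.
rewrite -[LHS]/(\pi_(coord_ring irr) p == 0 :> coord_ring irr).
rewrite -[0 in LHS](rmorph0 \pi_(coord_ring irr)).
by rewrite -(Quotient.idealrBE (vanishing_ideal irr)).
Qed.

End Fractions.

(* From here on, the fraction field is replaced by any field Omega with a
   morphism T from the polynomials with kernel the ideal of V: this keeps the
   quotient and fraction constructions out of the computations. *)
Section Pullback.
Variables (k : closedFieldType) (n : nat) (V : proj k n -> Prop).
Variable irr : irreducible_set V.
Notation poly := {mpoly k[n.+1]}.
Notation I := (in_ideal V).
Variables (Omega : fieldType) (T : {rmorphism poly -> Omega}).
Hypothesis T_eq0 : forall p, (T p == 0) = (p \in I).

Lemma T_eq p q : T p = T q <-> p - q \in I.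
Proof. by rewrite -T_eq0 rmorphB subr_eq0; split=> /eqP. Qed.

Section Standard.
Variables (m : nat) (F : m.+1.-tuple poly) (j0 : 'I_m.+1).
Hypothesis F_neq0 : tnth F j0 \notin I.
Hypothesis F_inj : forall b, b \mPo F \in I -> b = 0.
Variable phi : {P : proj k n | V P} -> proj k m.
Hypothesis phiF : forall j, given_by phi (tnth F j) F.

(** The pull-back of a form by F, which is injective by the hypothesis F_inj. *)
Definition pullback (a : {mpoly k[m.+1]}) : Omega := T (a \mPo F).
HB.instance Definition _ := GRing.RMorphism.copy pullback
  (T \o comp_mpoly F).

Lemma pullback_eq0 a : (pullback a == 0) = (a == 0).
Proof.
rewrite T_eq0; apply/idP/eqP=> [/F_inj //|->].
by rewrite comp_mpoly0 -T_eq0 rmorph0.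
Qed.

Lemma pullback_inj : injective pullback.
Proof.
move=> a b ab; apply/eqP; rewrite -subr_eq0 -pullback_eq0 rmorphB subr_eq0.
exact/eqP.
Qed.

(** The pull-back of the function field of the target, computed with F. *)
Definition pullback_frac (f : Omega) : Prop := exists d a b,
  [/\ a \is d.-homog, b \is d.-homog, b != 0 & f = pullback a / pullback b].

Lemma T_comp (G : m.+1.-tuple poly) a :
  T (a \mPo G) = mmap (T \o @mpolyC _ _) (fun j => T (tnth G j)) a.
Proof. by rewrite /comp_mpoly (rmorph_mmap _ T). Qed.

(** Two tuples of forms that give the same map differ by a factor in Omega. *)
Lemma given_by_scale h G : given_by phi h G -> h \notin I ->
  exists c : Omega, forall j, T (tnth G j) = c * T (tnth F j).
Proof.
move=> [[e he] [d hG] phiG] h_neq0.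
exists (T (tnth G j0) / T (tnth F j0)) => j.
have F0 : T (tnth F j0) != 0 by rewrite T_eq0.
apply: (mulIf F0); rewrite mulrAC mulrC mulfVK // -!rmorphM.
apply/T_eq.
have [_ [dF hF] _] := phiF j0.
suff : h * (tnth F j0 * (tnth G j * tnth F j0 - tnth G j0 * tnth F j)) \in I.
  move/(ideal_prime irr); rewrite (negPf h_neq0) => /(ideal_prime irr).
  by rewrite (negPf F_neq0) mulrC.
have hom : h * (tnth F j0 * (tnth G j * tnth F j0 - tnth G j0 * tnth F j))
    \is (e + (dF + (d + dF))).-homog.
  by apply/dhomogM/dhomogM/rpredB; rewrite ?hF //; apply: dhomogM.
apply/in_idealP => P VP; have [v v0 eP] := proj_rep P.
have vP : v \in val P by rewrite eP memv_line.
apply/(vanishes_homog hom vP v0); rewrite !mevalM.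
have [->|hv] := eqVneq h.@[v 0] 0; first by rewrite mul0r.
have [->|Fv] := eqVneq (tnth F j0).@[v 0] 0; first by rewrite mul0r mulr0.
have eG : val (phi (exist _ P VP)) = <[values G v]>%VS.
  by apply: phiG => //= /(vanishes_homog he vP v0)/eqP; rewrite (negPf hv).
have eF : val (phi (exist _ P VP)) = <[values F v]>%VS.
  have [_ _] := phiF j0; apply=> //=.
  by move=> /(vanishes_homog (hF j0) vP v0)/eqP; rewrite (negPf Fv).
have /vlineP[c /rowP eGF] : values G v \in <[values F v]>%VS.
  by rewrite -eF eG memv_line.
have {}eGF l : (tnth G l).@[v 0] = c * (tnth F l).@[v 0].
  by have := eGF l; rewrite !mxE.
by rewrite mevalB !mevalM !eGF; ring.
Qed.

(** The pull-back of a rational function does not depend on the forms that give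
    the map. *)
Lemma pullback_fieldE f : (exists h G d (a b : {mpoly k[m.+1]}),
    [/\ given_by phi h G /\ h \notin I,
        a \is d.-homog, b \is d.-homog, b \mPo G \notin I
      & f = T (a \mPo G) / T (b \mPo G)]) <-> pullback_frac f.
Proof.
split=> [[h [G [d [a [b [[Gh h_neq0] ha hb b_neq0 ->]]]]]] | ].
  have [c eG] := given_by_scale Gh h_neq0.
  have scale a' : a' \is d.-homog -> T (a' \mPo G) = c ^+ d * pullback a'.
    move=> ha'; rewrite /pullback !T_comp -mmap_homog //.
    exact: mmap_eq.
  move: b_neq0; rewrite -T_eq0 !scale // mulf_eq0 negb_or => /andP[c0 b0].
  exists d, a, b; split=> //; first by rewrite -pullback_eq0.
  by rewrite -mulf_div divff // mul1r.
move=> [d [a [b [ha hb b0 ->]]]]; exists (tnth F j0), F, d, a, b; split=> //.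
by rewrite -[_ \in _]T_eq0 -[T _]/(pullback b) pullback_eq0.
Qed.

Lemma pullback_frac1 : pullback_frac 1.
Proof.
exists 0%N, 1, 1; rewrite !dhomog1 oner_neq0.
by split; rewrite // rmorph1 divr1.
Qed.

Lemma pullback_fracB x y :
  pullback_frac x -> pullback_frac y -> pullback_frac (x - y).
Proof.
move=> [d [a [b [ha hb b0 ->]]]] [d' [a' [b' [ha' hb' b0' ->]]]].
exists (d + d')%N, (a * b' - a' * b), (b * b'); split.
- by apply: rpredB; [|rewrite addnC]; apply: dhomogM.
- exact: dhomogM.
- by rewrite mulf_neq0.
by rewrite -mulNr addf_div ?pullback_eq0 // mulNr rmorphB !rmorphM.
Qed.

Lemma pullback_fracM x y :
  pullback_frac x -> pullback_frac y -> pullback_frac (x * y).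
Proof.
move=> [d [a [b [ha hb b0 ->]]]] [d' [a' [b' [ha' hb' b0' ->]]]].
exists (d + d')%N, (a * a'), (b * b'); split; try exact: dhomogM.
  by rewrite mulf_neq0.
by rewrite mulf_div !rmorphM.
Qed.

Lemma pullback_fracV x : pullback_frac x -> pullback_frac x^-1.
Proof.
move=> [d [a [b [ha hb b0 ->]]]]; have [->|a0] := eqVneq a 0.
  rewrite rmorph0 mul0r invr0 -(subrr 1).
  exact: pullback_fracB pullback_frac1 pullback_frac1.
by exists d, b, a; rewrite invf_div.
Qed.

Lemma pullback_frac_div d a b : a \is d.-homog -> b \is d.-homog -> b != 0 ->
  pullback_frac (pullback a / pullback b).
Proof. by move=> ha hb b0; exists d, a, b. Qed.

Lemma pullback_frac_cst c : pullback_frac (T c%:MP).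
Proof.
exists 0%N, c%:MP, 1; rewrite dhomog1 oner_neq0; split=> //.
  by rewrite -[_%:MP]mulr1 mul_mpolyC dhomogZ ?dhomog1.
by rewrite rmorph1 divr1 /pullback comp_mpolyC.
Qed.

(* The ratio e = l1 / l0 of two linear forms is quadratic over the pulled back
   field, by quad, and not in this field, by disc. By coord, the ratios of all
   coordinates to l0 are in the extension generated by e. *)
Section Degree.
Variables (l0 l1 : poly).
Hypotheses (l0_homog : l0 \is 1.-homog) (l1_homog : l1 \is 1.-homog)
  (l0_neq0 : l0 \notin I).
Variables (d : nat) (c0 c1 c2 : {mpoly k[m.+1]}).
Hypotheses (hc0 : c0 \is d.-homog) (hc1 : c1 \is d.-homog)
  (hc2 : c2 \is d.-homog) (c2_neq0 : c2 != 0)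
  (quad : (c2 \mPo F) * l1 ^+ 2 + (c1 \mPo F) * (l0 * l1)
            + (c0 \mPo F) * l0 ^+ 2 \in I)
  (disc : forall A B, A ^+ 2 = (c1 ^+ 2 - 4%:R * (c2 * c0)) * B ^+ 2 -> B = 0).
Hypothesis coord : forall j : 'I_n.+1, exists d' (a b p q r : {mpoly k[m.+1]}),
  [/\ [/\ a \is d'.-homog, b \is d'.-homog, p \is d'.-homog, q \is d'.-homog
     & r \is d'.-homog], (a != 0) || (b != 0) &
   'X_j * ((a \mPo F) * l0 + (b \mPo F) * l1)
     - ((p \mPo F) * l0 ^+ 2 + (q \mPo F) * (l0 * l1) + (r \mPo F) * l1 ^+ 2)
       \in I].

Let e := T l1 / T l0.
Let L0 : T l0 != 0. Proof. by rewrite T_eq0. Qed.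
Let L1 : T l1 = e * T l0. Proof. by rewrite /e mulfVK. Qed.

Let e_quad : pullback c2 * e ^+ 2 + pullback c1 * e + pullback c0 = 0.
Proof.
move: quad; rewrite -T_eq0 !(rmorphD, rmorphM, rmorphXn) /=.
rewrite -[T (c2 \mPo F)]/(pullback c2).
rewrite -[T (c1 \mPo F)]/(pullback c1).
rewrite -[T (c0 \mPo F)]/(pullback c0) L1.
set p := pullback c2; set q := pullback c1; set r := pullback c0 => E.
apply/(mulIf (expf_neq0 2 L0))/eqP; rewrite mul0r -(eqP E); apply/eqP; ring.
Qed.

Let e_sq : e ^+ 2
  = (- pullback c1 / pullback c2) * e + (- pullback c0 / pullback c2).
Proof.
have C2 : pullback c2 != 0 by rewrite pullback_eq0.
apply: (mulfI C2); apply/eqP; rewrite -subr_eq0; apply/eqP.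
by rewrite -[RHS]e_quad; field.
Qed.

(* If e = A / B, then the discriminant times B ^+ 2 is the square of
   2 c2 A + c1 B. *)
Let Ke : ~ pullback_frac e.
Proof.
move=> [d' [A [B [_ _ B0 eE]]]]; move/eqP: (B0); apply.
apply: (@disc (2%:R * c2 * A + c1 * B)); apply: pullback_inj.
have PB0 : pullback B != 0 by rewrite pullback_eq0.
have eA : pullback A = e * pullback B by rewrite eE mulfVK.
rewrite !(rmorphXn, rmorphM, rmorphD, rmorphB, rmorph_nat) /= eA.
apply/eqP; rewrite -subr_eq0; apply/eqP.
transitivity (4%:R * pullback c2 * pullback B ^+ 2
  * (pullback c2 * e ^+ 2 + pullback c1 * e + pullback c0)); first by ring.
by rewrite e_quad mulr0.
Qed.

Let Kt : pullback_frac (- pullback c1 / pullback c2).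
Proof.
by rewrite -rmorphN; apply: pullback_frac_div hc2 c2_neq0; rewrite rpredN.
Qed.
Let Kn : pullback_frac (- pullback c0 / pullback c2).
Proof.
by rewrite -rmorphN; apply: pullback_frac_div hc2 c2_neq0; rewrite rpredN.
Qed.

Local Notation L := (adjoin pullback_frac e).
Let LM := adjoinM pullback_frac1 pullback_fracB pullback_fracM Kt Kn e_sq.
Let LV := adjoinV pullback_frac1 pullback_fracB pullback_fracM pullback_fracV
  Kt Kn e_sq Ke.
Let LD := adjoinD pullback_frac1 pullback_fracB.
Let Lb := adjoin_base pullback_frac1 pullback_fracB e.

Let coord_adjoin j : L (T 'X_j / T l0).
Proof.
have [d' [a [b [p [q [r [[ha hb hp hq hr] ab0 rel]]]]]]] := coord j.
(* Dividing by a nonzero form s of the same degree puts all coefficients of the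
   relation in the pulled back field. *)
have [s [hs s0]] : exists s : {mpoly k[m.+1]}, s \is d'.-homog /\ s != 0.
  by case/orP: ab0 => ?; [exists a | exists b].
have Ks u : u \is d'.-homog -> L (pullback u / pullback s).
  by move=> hu; apply/Lb/(pullback_frac_div hu hs s0).
have Le : L e by exact: adjoin_gen pullback_frac1 pullback_fracB e.
have S0 : pullback s != 0 by rewrite pullback_eq0.
pose y := pullback a / pullback s + pullback b / pullback s * e.
have y0 : y != 0.
  apply: contraTneq ab0 => Y; rewrite negb_or !negbK.
  have [||A0 B0] := adjoin_free pullback_frac1 pullback_fracB pullback_fracM
    pullback_fracV Ke _ _ Y.
  - exact: pullback_frac_div ha hs s0.
  - exact: pullback_frac_div hb hs s0.
  move/eqP: A0; rewrite mulf_eq0 invr_eq0 (negPf S0) orbF pullback_eq0 => ->.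
  by move/eqP: B0; rewrite mulf_eq0 invr_eq0 (negPf S0) orbF pullback_eq0 => ->.
have -> : T 'X_j / T l0 = (pullback p / pullback s + pullback q / pullback s * e
    + pullback r / pullback s * (e * e)) * y^-1.
  apply: (mulIf y0); rewrite mulfVK // /y.
  move: rel; rewrite -T_eq0 !(rmorphB, rmorphD, rmorphM, rmorphXn) /=.
  rewrite -/(pullback a) -/(pullback b) -/(pullback p) -/(pullback q).
  rewrite -/(pullback r) L1 subr_eq0 -[T 'X_j](mulfVK L0) => /eqP rel.
  rewrite mulfVK //; set x := T 'X_j / T l0 in rel *.
  have {}rel : x * (pullback a + pullback b * e)
      = pullback p + pullback q * e + pullback r * (e * e).
    apply: (mulIf (expf_neq0 2 L0)); transitivity (x * T l0
      * (pullback a * T l0 + pullback b * (e * T l0))); first by ring.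
    by rewrite rel; ring.
  transitivity (x * (pullback a + pullback b * e) / pullback s); first by field.
  by rewrite rel; field.
apply: LM; last by apply: LV; apply: LD; [exact: Ks | apply: LM; [exact: Ks|]].
by do 2?apply: LD; [exact: Ks | apply: LM; [exact: Ks|]
  | apply: LM; [exact: Ks | exact: LM]].
Qed.

Let form_adjoin d' p : p \is d'.-homog -> L (T p / T l0 ^+ d').
Proof.
move=> /dhomogP hp; rewrite [p]mpolyE rmorph_sum mulr_suml.
rewrite big_seq; apply: (big_ind L).
- apply: Lb; rewrite -(subrr 1).
  exact: pullback_fracB pullback_frac1 pullback_frac1.
- exact: LD.
move=> mm /hp <-; rewrite -mul_mpolyC rmorphM -mulrA; apply: LM.
  exact/Lb/pullback_frac_cst.
rewrite mpolyXE_id /= mdegE -prodrXr rmorph_prod -prodf_div.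
apply: (adjoin_prod pullback_frac1 pullback_fracB pullback_fracM Kt Kn e_sq).
move=> j; rewrite rmorphXn /= -expr_div_n.
elim: (mm j) => [|u IH]; first exact/Lb/pullback_frac1.
by rewrite exprS; apply: LM.
Qed.

(** The function field of V has degree 2 over the pulled back field. *)
Lemma degree_two : extension_degree
  (fun f => exists d a b, [/\ a \is d.-homog, b \is d.-homog, b \notin I
     & f = T a / T b]) pullback_frac 2.
Proof.
apply: (extension_degree_two pullback_frac1 pullback_fracB pullback_fracM
  pullback_fracV Ke).
- by exists 0%N, 1, 1; rewrite dhomog1 -[_ \in _]T_eq0 rmorph1 oner_neq0 divr1.
- by exists 1%N, l1, l0.
move=> _ [d' [a [b [ha hb b0 ->]]]].
have B0 : T b != 0 by rewrite T_eq0.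
have -> : T a / T b = (T a / T l0 ^+ d') * (T b / T l0 ^+ d')^-1.
  by rewrite invf_div mulrA mulfVK // expf_neq0.
by apply: LM; [exact: form_adjoin | apply/LV/form_adjoin].
Qed.

End Degree.
End Standard.
End Pullback.

(** * Forms on the Fermat quartic surface *)

Section Fermat.
Variables (k : closedFieldType) (i : k).
Hypotheses (char3 : 3 \in [pchar k]) (i_sq : i ^+ 2 = -1).
Notation X := (@fermat_quartic k).
Notation I := (in_ideal X).

Lemma fermat_coneP (P : proj k 3) v : v \in val P -> v != 0 ->
  X P <-> cone (v 0).
Proof.
have E u : (\sum_(j < 4) 'X_j ^+ 4 : {mpoly k[4]}).@[u] = \sum_j u j ^+ 4.
  by rewrite rmorph_sum; apply: eq_bigr => j _; rewrite rmorphXn /= mevalXU.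
move=> vP v0; rewrite /cone -E; apply: (vanishes_homog (d := 4)) => //.
apply: rpred_sum => j _; have : ('X_j : {mpoly k[4]}) \is 1.-homog.
  by rewrite dhomogX /= mdeg1.
by move/(dhomogMn 4).
Qed.

(** The point [1 : 1 : 1 : 0] is on the surface because 3 = 0. *)
Lemma fermat_nonempty : exists P, X P.
Proof.
pose v : 'rV[k]_4 := \row_j (j != ord_max)%:R.
have v0 : v != 0.
  apply: contraTneq (oner_neq0 k) => /rowP/(_ 0); rewrite !mxE /= => /eqP.
  by rewrite oner_eq0.
exists (point v0); apply/(@fermat_coneP (point v0) v); rewrite ?memv_line //.
rewrite /cone !big_ord_recl big_ord0 !mxE /= !expr1n expr0n /= !addr0.
by have := pcharf0 char3; rewrite !mulrS mulr0n addr0.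
Qed.

Lemma fermat_idealP p : reflect (forall v, cone v -> p.@[v] = 0) (p \in I).
Proof.
apply: (iffP (in_idealP _ _)) => [pI v cv | p0 P XP v vP]; last first.
  have [->|v0] := eqVneq v 0; last exact/p0/(fermat_coneP vP v0).
  by apply: p0; rewrite /cone big1 // => j _; rewrite mxE expr0n.
have ev : v =1 (\row_j v j) 0 by move=> j; rewrite mxE.
rewrite (meval_eq _ ev); have [v0|v0] := eqVneq (\row_j v j) 0.
  by have [P XP] := fermat_nonempty; apply: (pI P XP); rewrite v0 mem0v.
apply: (pI (point v0)) (memv_line _).
apply/(@fermat_coneP (point v0) _ (memv_line _) v0).
by rewrite /cone -[RHS]cv; apply: eq_bigr => j _; rewrite mxE.
Qed.

Lemma fermat_irreducible : irreducible_set X.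
Proof.
split; first exact: fermat_nonempty.
move=> p q /fermat_idealP pq0.
by case: (cone_prime char3 i_sq pq0) => r0; apply/orP; [left|right];
  apply/fermat_idealP.
Qed.

Lemma cone_scale c v : cone v -> cone (fun j => c * v j : k).
Proof.
rewrite /cone => cv; under eq_bigr do rewrite exprMn.
by rewrite -mulr_sumr cv mulr0.
Qed.

Section Descent.
(* The substitution s replaces the variable of index p by tnth s p and leaves
   the other variables unchanged. *)
Variables (m : nat) (s : m.-tuple {mpoly k[m]}) (p : 'I_m).
Hypothesis s_id : forall l, l != p -> tnth s l = 'X_l.

Lemma mpoly_divide (b : {mpoly k[m]}) :
  exists c, b = ('X_p - tnth s p) * c + (b \mPo s).
Proof.
elim/mpolyind: b => [|c mm b _ _ [q eq_b]].
  by exists 0; rewrite comp_mpoly0 mulr0 addr0.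
suff [q' eq_m] : exists q', 'X_[mm] = ('X_p - tnth s p) * q' + ('X_[mm] \mPo s).
  exists (c *: q' + q); rewrite comp_mpolyD comp_mpolyZ [in LHS]eq_b.
  by rewrite [in LHS]eq_m scalerDr scalerAr mulrDr addrACA.
rewrite comp_mpolyX mpolyXE_id.
elim/big_ind2: _ => [|x y u v [q1 e1] [q2 e2]|l _].
- by exists 0; rewrite mulr0 add0r.
- by exists (q1 * u + y * q2); rewrite e1 e2; ring.
have [->|/s_id ->] := eqVneq l p; last by exists 0; rewrite mulr0 add0r.
have [q1 e1] : exists q1,
    'X_p ^+ mm p - tnth s p ^+ mm p = ('X_p - tnth s p) * q1.
  by rewrite subrXX; eexists.
by exists q1; rewrite -e1 subrK.
Qed.

(** A property of polynomials that makes them divisible by the linear form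
    'X_p - tnth s p, and that passes to the quotient, holds at most for 0. *)
Lemma descent (P : {mpoly k[m]} -> Prop) :
    (forall b, P b -> b \mPo s = 0) ->
    (forall c, P (('X_p - tnth s p) * c) -> P c) ->
    'X_p - tnth s p != 0 -> 'X_p - tnth s p \is 1.-homog ->
  forall b, P b -> b = 0.
Proof.
set l := 'X_p - tnth s p => Ps Pl l0 hl b; have [N] := ubnP (msize b).
elim: N b => // N IH b lt_b Pb; have [c] := mpoly_divide b.
rewrite (Ps b Pb) addr0 => eb; have [->|b0] := eqVneq b 0; first by [].
have c0 : c != 0 by apply: contra_neq b0 => c0; rewrite eb c0 mulr0.
rewrite eb (IH c) ?mulr0 //; last by apply: Pl; rewrite -eb.
move: lt_b; rewrite eb msizeM //.
have -> : msize l = 2%N.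
  by rewrite -mlead_deg //; congr S; apply: (dhomog_mf hl (mlead_supp l0)).
exact.
Qed.

End Descent.

Variables (delta : nat) (F : 3.-tuple {mpoly k[4]}).
Hypotheses (delta_gt0 : (0 < delta)%N)
  (hF : forall j, tnth F j \is delta.-homog).

(** Algebraic independence of F on the surface: the tuple line parametrises a
    curve on the surface that F maps onto the line of equation 'X_p = tnth s
    p, with g as common factor of the values of F. A polynomial b with b \mPo
    F = 0 on the surface vanishes on this line. So it is divisible by the
    equation of the line, whose pull-back is not zero on the surface, and the
    quotient has the same property. *)
Lemma fermat_comp_eq0 (s : 3.-tuple {mpoly k[3]}) (p : 'I_3)
    (g : {mpoly k[3]}) (line : 'I_4 -> {mpoly k[3]}) :
    (forall l, l != p -> tnth s l = 'X_l) ->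
    'X_p - tnth s p \is 1.-homog ->
    ('X_p - tnth s p) \mPo F \notin I ->
    g != 0 ->
    (forall u, cone (fun j => (line j).@[u])) ->
    (forall u j, (tnth F j).@[fun l => (line l).@[u]]
                   = g.@[u] * (tnth s j).@[u]) ->
  forall b, b \mPo F \in I -> b = 0.
Proof.
move=> s_id hl lF g0 cl Fl; apply: (descent s_id) => // [b bF|c|].
- have: g * (b \mPo s) = 0.
    apply: mpoly_vanish => u; rewrite mevalM comp_mpoly_meval.
    have [->|gu] := eqVneq g.@[u] 0; first by rewrite mul0r.
    (* Scaling the point of the curve by c removes the factor g. *)
    have [c cd] : exists c, c ^+ delta = g.@[u]^-1.
      have [c] := @solve_monicpoly k delta
        (fun j => if j == 0%N then g.@[u]^-1 else 0) delta_gt0.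
      move: delta_gt0; case: (delta) => // d' _.
      rewrite big_ord_recl big1 => [|j _]; last by rewrite mul0r.
      by rewrite expr0 mulr1 addr0; exists c.
    have /fermat_idealP/(_ _ (cone_scale c (cl u))) := bF.
    rewrite comp_mpoly_meval => bu.
    have <- : b.@[fun j => (tnth F j).@[fun l => c * (line l).@[u]]]
        = b.@[fun j => (tnth s j).@[u]].
      by apply: meval_eq => j; rewrite (meval_homog _ _ (hF j)) cd Fl mulKf.
    by rewrite bu mulr0.
  by move/eqP; rewrite mulf_eq0 (negPf g0) => /eqP.
- rewrite rmorphM /= => /(ideal_prime fermat_irreducible).
  by rewrite (negPf lF).
apply: contraNneq lF => ->; rewrite comp_mpoly0.
by apply/fermat_idealP => v _; rewrite meval0.
Qed.

Lemma fermat_dominant (phi : {P | X P} -> proj k 2) :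
    (forall j, given_by phi (tnth F j) F) ->
    (forall b, b \mPo F \in I -> b = 0) ->
  dominant phi.
Proof.
move=> phiF F_inj d b hb b0; apply: F_inj; apply/in_idealP => P XP.
move=> v vP; rewrite comp_mpoly_meval.
have eb : b.@[fun j => (tnth F j).@[v 0]] = b.@[(values F v) 0].
  by apply: meval_eq => j; rewrite mxE.
rewrite eb; apply: (b0 (exist _ P XP)).
have [->|Fv] := eqVneq (values F v) 0; first exact: mem0v.
have [j Fj] := values_neq0 Fv.
have v0 : v != 0.
  apply: contraNneq Fj => ->.
  rewrite (@meval_eq _ _ _ (fun l => 0 * 0)) => [|l].
    by rewrite (meval_homog _ _ (hF j)) expr0n eqn0Ngt delta_gt0 mul0r.
  by rewrite mxE mulr0.
have [_ _ /(_ (exist _ P XP)) ev] := phiF j.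
rewrite (ev _ v vP v0) ?memv_line //=.
by move/(vanishes_homog (hF j) vP v0)/eqP; rewrite (negPf Fj).
Qed.

End Fermat.

(** * Certificates *)

Declare Scope expr_scope.
Delimit Scope expr_scope with E.
Bind Scope expr_scope with expr.
Notation "0" := (Cst zero9) : expr_scope.
Notation "1" := (Cst one9) : expr_scope.
Notation "a + b" := (Add a b) : expr_scope.
Notation "- a" := (Opp a) : expr_scope.
Notation "a - b" := (Add a (Opp b)) : expr_scope.
Notation "a * b" := (Mul a b) : expr_scope.
Notation "a ^+ n" := (Exp a n) : expr_scope.

Definition sum_expr (s : seq expr) : expr := foldr Add (Cst zero9) s.
Definition fermat_expr : expr :=
  (Var 0 ^+ 4 + Var 1 ^+ 4 + Var 2 ^+ 4 + Var 3 ^+ 4)%E.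
Definition fermat_rule :=
  (Var 0 ^+ 4, - (Var 1 ^+ 4 + Var 2 ^+ 4 + Var 3 ^+ 4))%E.

(** Equality modulo the equation of the Fermat quartic. *)
Definition onX e1 e2 := same [:: fermat_rule] e1 e2.
Definition vanishes e := onX e (Cst zero9).
Definition identical e1 e2 := same [::] e1 e2.
Definition combine (s t : seq expr) :=
  sum_expr [seq Mul c.1 c.2 | c <- zip s t].

(** The polynomial in the variable q with coefficients s, by increasing
    degrees. *)
Definition horner_expr q (s : seq expr) :=
  foldr (fun d e => d + Var q * e)%E (Cst zero9) s.

(** The variable q does not occur. *)
Fixpoint avoids q e := match e with
  | Cst _ => true
  | Var j => j != q
  | Add a b | Mul a b => avoids q a && avoids q b
  | Opp a | Exp a _ => avoids q a
  end.

Definition nonzero_at v e := ~~ eq9 (eval9 v e) zero9.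
Definition of_degree d (s : seq expr) := all (fun e => degree e == Some d) s.

(** The data of a proof that three forms define a morphism of degree 2 from
    the Fermat quartic surface to the plane. Space coordinates are the
    variables 0 to 3, plane coordinates the variables 0 to 2.
    - ct_map: three forms of degree ct_deg;
    - ct_reps: further triples of forms of degree ct_rep_deg, proportional to
      ct_map on the surface;
    - ct_bezout: for each of the variables 1, 2, 3, the coefficients of a
      linear combination of all these forms that is equal on the surface to
      the power of exponent ct_exp of the variable;
    - ct_line: a parametrisation, by the variables 1 and 2, of a line on the
      surface, where the forms of ct_map are ct_factor times a Var 1 + b Var
      2, Var 1, Var 2, with (a, b) = ct_image;
    - ct_l0, ct_l1: two linear forms on the space;
    - ct_quad: forms c0, c1, c2 of degree ct_quad_deg on the plane, such that
      c2 l1^2 + c1 l0 l1 + c0 l0^2 = 0 on the surface, where plane forms are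
      pulled back by ct_map;
    - ct_disc: the coefficients, by increasing degrees, of c1^2 - c0 c2 as a
      polynomial of odd degree in the variable ct_axis; in characteristic 3
      this is the discriminant c1^2 - 4 c0 c2;
    - ct_coord: for each space coordinate X, forms a, b, p, q, r of degree
      ct_coord_deg on the plane such that on the surface X (a l0 + b l1) = p
      l0^2 + q l0 l1 + r l1^2;
    - ct_cone_point, ct_plane_point: points where the forms that have to be
      nonzero do not vanish; the first one is on the cone over the surface and
      its last coordinate is 1. *)
Record certificate := Certificate {
  ct_map : seq expr; ct_deg : nat;
  ct_reps : seq (seq expr); ct_rep_deg : nat;
  ct_exp : nat; ct_bezout : seq (seq expr);
  ct_line : seq expr; ct_factor : expr; ct_image : F9 * F9;
  ct_l0 : expr; ct_l1 : expr;
  ct_quad : seq expr; ct_quad_deg : nat;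
  ct_axis : nat; ct_disc : seq expr;
  ct_coord : seq (seq expr); ct_coord_deg : nat;
  ct_cone_point : seq F9; ct_plane_point : seq F9
}.

Definition proportional_expr (f g : seq expr) :=
  all (fun jl => onX (Mul (nth 0%E f jl.1) (nth 0%E g jl.2))
                     (Mul (nth 0%E f jl.2) (nth 0%E g jl.1)))
    [:: (0, 1); (0, 2); (1, 2)]%N.

Section Validity.
Variable ct : certificate.
Let f j := nth 0%E (ct_map ct) j.
Let on_map e := subst (ct_map ct) e.
Let l0 := ct_l0 ct.
Let l1 := ct_l1 ct.
Let c j := nth 0%E (ct_quad ct) j.

Definition valid_reps :=
  [&& (0 < ct_deg ct)%N, size (ct_map ct) == 3,
      of_degree (ct_deg ct) (ct_map ct)
    & all (fun g => [&& size g == 3, of_degree (ct_rep_deg ct) g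
                      & proportional_expr (ct_map ct) g]) (ct_reps ct)].

Definition valid_bezout :=
  all (fun j => onX (Exp (Var j.+1) (ct_exp ct))
     (combine (nth [::] (ct_bezout ct) j) (flatten (ct_map ct :: ct_reps ct))))
   (iota 0 3).

(** The right-hand side of the equation of the image line. *)
Definition image_expr :=
  (Cst (ct_image ct).1 * Var 1 + Cst (ct_image ct).2 * Var 2)%E.

Definition valid_line :=
  [&& size (ct_line ct) == 4, identical (subst (ct_line ct) fermat_expr) 0,
      nonzero_at (ct_plane_point ct) (ct_factor ct),
      nonzero_at (ct_cone_point ct) (on_map (Var 0 - image_expr)%E) &
      all (fun j => identical (subst (ct_line ct) (f j))
         (ct_factor ct * nth 0%E [:: image_expr; Var 1; Var 2] j)) (iota 0 3)].

Definition valid_quad :=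
  [&& degree l0 == Some 1%N, degree l1 == Some 1%N,
      nonzero_at (ct_cone_point ct) l0,
      of_degree (ct_quad_deg ct) [seq c j | j <- iota 0 3],
      nonzero_at (ct_plane_point ct) (c 2) &
      vanishes (on_map (c 2) * l1 ^+ 2 + on_map (c 1) * (l0 * l1)
                  + on_map (c 0) * l0 ^+ 2)].

Definition valid_disc :=
  [&& (ct_axis ct < 3)%N, odd (size (ct_disc ct)).-1,
      all (avoids (ct_axis ct)) (ct_disc ct),
      nonzero_at (ct_plane_point ct) (last 0%E (ct_disc ct)) &
      identical (c 1 ^+ 2 - c 2 * c 0) (horner_expr (ct_axis ct) (ct_disc ct))].

Definition valid_coord :=
  all (fun j => let r := nth 0%E (nth [::] (ct_coord ct) j) in
    [&& of_degree (ct_coord_deg ct) [seq r l | l <- iota 0 5],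
        nonzero_at (ct_plane_point ct) (r 0)
          || nonzero_at (ct_plane_point ct) (r 1) &
        vanishes (Var j * (on_map (r 0) * l0 + on_map (r 1) * l1)
          - (on_map (r 2) * l0 ^+ 2 + on_map (r 3) * (l0 * l1)
               + on_map (r 4) * l1 ^+ 2))])
   (iota 0 4).

Definition valid_points :=
  [&& size (ct_cone_point ct) == 4, size (ct_plane_point ct) == 3,
      eq9 (nth zero9 (ct_cone_point ct) 3) one9,
      ~~ nonzero_at (ct_cone_point ct) fermat_expr
    & nonzero_at (ct_cone_point ct) (f 0)].

Definition valid :=
  [&& valid_reps, valid_bezout, valid_line, valid_quad, valid_disc, valid_coord
    & valid_points].

End Validity.

(** * Soundness of the certificates *)

Section Soundness.
Variables (k : closedFieldType) (i : k).
Hypotheses (char3 : 3 \in [pchar k]) (i_sq : i ^+ 2 = -1).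
Notation X := (@fermat_quartic k).
Notation I := (in_ideal X).
Local Notation form := (poly_of i).

Lemma formD n a b : form n (Add a b) = form n a + form n b. Proof. by []. Qed.
Lemma formN n a : form n (Opp a) = - form n a. Proof. by []. Qed.
Lemma formM n a b : form n (Mul a b) = form n a * form n b. Proof. by []. Qed.
Lemma formX n a m : form n (Exp a m) = form n a ^+ m. Proof. by []. Qed.
Lemma form0 n : form n 0%E = 0. Proof. exact: val9_0. Qed.

Lemma onX_sound e1 e2 : onX e1 e2 -> form 4 e1 - form 4 e2 \in I.
Proof.
move=> e12; apply/(fermat_idealP char3) => v cv.
rewrite mevalB !poly_of_meval (same_sound char3 i_sq _ e12) ?subrr //=.
split=> //; move: cv; rewrite /cone enum_ordSl /= => cv.
apply/eqP; rewrite -addr_eq0; apply/eqP; rewrite -[RHS]cv.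
by rewrite !(enum_ordSl, enum_ord0) /= !big_ord_recl big_ord0 !addr0 !addrA.
Qed.

Lemma identical_sound n e1 e2 : identical e1 e2 -> form n e1 = form n e2.
Proof.
move=> e12; apply/eqP; rewrite -subr_eq0; apply/eqP/mpoly_vanish => v.
by rewrite mevalB !poly_of_meval (same_sound char3 i_sq _ e12) ?subrr.
Qed.

(** The tuple of the first m polynomials of a list. *)
Definition forms n m (s : seq expr) : m.-tuple {mpoly k[n]} :=
  [tuple form n (nth 0%E s j) | j < m].

Lemma size_map_enum (T : Type) n (f : 'I_n -> T) :
  size [seq f j | j <- enum 'I_n] = n.
Proof. by rewrite size_map size_enum_ord. Qed.

Lemma nth_map_enum (T : Type) (x0 : T) n (f : 'I_n -> T) j (lt_j : (j < n)%N) :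
  nth x0 [seq f j | j <- enum 'I_n] j = f (Ordinal lt_j).
Proof.
rewrite (nth_map (Ordinal lt_j)) ?size_enum_ord //; congr f.
by apply: val_inj; rewrite /= nth_enum_ord.
Qed.

Lemma form_var n (j : 'I_n) : form n (Var j) = 'X_j.
Proof.
rewrite -[LHS]/(nth 0 [seq 'X_l | l <- enum 'I_n] j).
by rewrite (nth_map_enum _ _ (ltn_ord j)); congr ('X_ _); apply: val_inj.
Qed.

Lemma form_subst n m s e : size s = m ->
  form n (subst s e) = form m e \mPo forms n m s.
Proof.
move=> sz; rewrite (poly_of_rmorph i (comp_mpoly (forms n m s))) /= comp_mpolyC.
rewrite {1}/poly_of eval_subst; congr (eval _ _ _).
apply: (@eq_from_nth _ 0) => [|j]; rewrite size_map sz ?size_map_enum //.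
move=> lt_j; rewrite (nth_map 0%E) ?sz //.
rewrite (nth_map (Ordinal lt_j)) ?size_enum_ord //.
by rewrite comp_mpolyXU -tnth_nth tnth_mktuple nth_enum_ord.
Qed.

Definition point9 n (v : seq F9) : 'I_n -> k := fun j => val9 i (nth zero9 v j).

Lemma form_point n v e :
  size v = n -> (form n e).@[point9 v] = val9 i (eval9 v e).
Proof.
move=> sz; rewrite poly_of_meval -eval_val9 //; congr (eval _ _ _).
apply: (@eq_from_nth _ 0) => [|j]; rewrite size_map_enum ?size_map // => lt_j.
rewrite (nth_map (Ordinal lt_j)) ?size_enum_ord // (nth_map zero9) ?sz //.
by rewrite /point9 nth_enum_ord.
Qed.

Lemma nonzero_sound n v e : size v = n -> nonzero_at v e ->
  (form n e).@[@point9 n v] != 0.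
Proof. by move=> sz; rewrite form_point //; apply: val9_neq0. Qed.

Lemma eval_avoids (R : comNzRingType) (iR : R) (s t : seq R) q e :
  (forall j, j != q -> s`_j = t`_j) -> avoids q e -> eval iR s e = eval iR t e.
Proof.
move=> st; elim: e => [c|j|a IHa b IHb|a IHa|a IHa b IHb|a IHa n] //=.
- exact: st.
- by case/andP=> /IHa -> /IHb ->.
- by move/IHa ->.
- by case/andP=> /IHa -> /IHb ->.
- by move/IHa ->.
Qed.

Let axis (q j : 'I_3) : k := (j == q)%:R.

Lemma along_var q v (j : 'I_3) :
  along v (axis q) 'X_j = (v j)%:P + (j == q)%:R *: 'X.
Proof. by rewrite /along mmapX mmap1U. Qed.

Lemma avoids_along (q : 'I_3) e (v : 'I_3 -> k) : avoids q e ->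
  along v (axis q) (form 3 e) = ((form 3 e).@[v])%:P.
Proof.
move=> qe; rewrite (poly_of_rmorph i (along v (axis q))).
rewrite poly_of_meval rmorph_eval.
rewrite [X in eval X _ _ = _](_ : _ = i%:P); last exact: mmapC.
apply: (@eval_avoids _ _ _ _ q _ _ qe) => j jq.
have [lt_j|le_j] := ltnP j 3; last first.
  by rewrite !nth_default ?(size_map polyC) ?size_map_enum.
rewrite nth_map_enum (nth_map 0) ?size_map_enum // nth_map_enum.
rewrite [LHS]along_var (_ : (_ == q) = false) ?scale0r ?addr0 //.
by apply: contraNF jq => /eqP <-.
Qed.

(** On a line parallel to the axis of the variable q, a polynomial written by
    powers of this variable has the expected degree where its leading
    coefficient is not zero. *)
Lemma size_along_horner (q : 'I_3) (s : seq expr) (v : 'I_3 -> k) :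
    all (avoids q) s -> (form 3 (last 0%E s)).@[v] != 0 ->
  size (along v (axis q) (form 3 (horner_expr q s))) = size s.
Proof.
move=> avs nz.
have -> : along v (axis q) (form 3 (horner_expr q s))
    = (Poly [seq (form 3 d).@[v] | d <- s]) \Po ('X + (v q)%:P).
  elim: s avs {nz} => [|d s IH] /=.
    move=> _; rewrite comp_poly0 -[form 3 _]/(val9 _ _).
    by rewrite val9_0 rmorph0.
  case/andP=> av_d /IH {}IH.
  rewrite cons_poly_def comp_polyD comp_polyM comp_polyC comp_polyX -IH.
  rewrite formD formM [LHS]rmorphD [X in _ + X]rmorphM /=.
  rewrite avoids_along // form_var along_var.
  by rewrite eqxx scale1r addrC mulrC ['X + _]addrC.
rewrite size_comp_poly2; last by rewrite size_XaddC.
rewrite (@PolyK _ 0) ?size_map //.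
case: s nz {avs} => [|d s] /=.
  by rewrite -[form 3 _]/(val9 _ _) val9_0 meval0 eqxx.
by rewrite (last_map (fun d => (form 3 d).@[v])).
Qed.

Section Certificate.
Variable ct : certificate.
Hypothesis ct_ok : valid ct.

Let reps_ok : valid_reps ct. Proof. by case/and5P: ct_ok. Qed.
Let bezout_ok : valid_bezout ct. Proof. by case/and5P: ct_ok. Qed.
Let line_ok : valid_line ct. Proof. by case/and5P: ct_ok. Qed.
Let quad_ok : valid_quad ct. Proof. by case/and5P: ct_ok. Qed.
Let disc_ok : valid_disc ct.
Proof. by case/and5P: ct_ok => _ _ _ _ /and3P[]. Qed.
Let coord_ok : valid_coord ct.
Proof. by case/and5P: ct_ok => _ _ _ _ /and3P[]. Qed.
Let points_ok : valid_points ct.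
Proof. by case/and5P: ct_ok => _ _ _ _ /and3P[]. Qed.

Let F := forms 4 3 (ct_map ct).
Let cone_pt := @point9 4 (ct_cone_point ct).

Let cone_pt_cone : cone cone_pt.
Proof.
case/and5P: points_ok => /eqP sz _ _ + _; rewrite /nonzero_at negbK.
move=> /eq9_eq e0.
have := form_point fermat_expr sz; rewrite e0 val9_0 => pt0.
rewrite /cone -[RHS]pt0 poly_of_meval !(enum_ordSl, enum_ord0) /=.
by rewrite !big_ord_recl big_ord0 addr0 !addrA.
Qed.

Let nonzero_cone e : nonzero_at (ct_cone_point ct) e -> form 4 e \notin I.
Proof.
case/and5P: points_ok => /eqP sz _ _ _ _ /(nonzero_sound sz).
by apply: contra => /(fermat_idealP char3)/(_ _ cone_pt_cone) ->.
Qed.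

Let nonzero_plane e : nonzero_at (ct_plane_point ct) e -> form 3 e != 0.
Proof.
case/and5P: points_ok => _ /eqP sz _ _ _ /(nonzero_sound sz).
by apply: contra_neq => ->; rewrite meval0.
Qed.

Let F_size : size (ct_map ct) = 3.
Proof. by case/and4P: reps_ok => _ /eqP. Qed.

Let on_map e : form 4 (subst (ct_map ct) e) = form 3 e \mPo F.
Proof. exact: form_subst. Qed.

Lemma forms_homog d n m s : size s = m -> of_degree d s ->
  forall j, tnth (forms n m s) j \is d.-homog.
Proof.
rewrite /of_degree => sz /(all_nthP 0%E) hs j; rewrite tnth_mktuple.
by apply: poly_of_homog; apply/eqP/hs; rewrite sz.
Qed.

Let F_homog j : tnth F j \is (ct_deg ct).-homog.
Proof. by case/and4P: reps_ok => _ _ dF _; apply: forms_homog. Qed.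

Let F0 : tnth F 0 \notin I.
Proof. by rewrite tnth_mktuple; apply: nonzero_cone; case/and5P: points_ok. Qed.

Let F_inj b : b \mPo F \in I -> b = 0.
Proof.
case/and5P: line_ok => /eqP sz cl g0 lF /allP Fl.
case/and4P: reps_ok => d0 _ _ _.
pose s : 3.-tuple {mpoly k[3]} :=
  forms 3 3 [:: image_expr ct; Var 1; Var 2].
pose line := forms 3 4 (ct_line ct).
have s0 : tnth s 0 = form 3 (image_expr ct) by rewrite tnth_mktuple.
have X0 : 'X_0 - tnth s 0 = form 3 (Var 0 - image_expr ct)%E.
  by rewrite s0 -form_var.
apply: (@fermat_comp_eq0 _ _ char3 i_sq _ _ d0 F_homog s 0
  (form 3 (ct_factor ct)) (fun j => tnth line j)) => [l l0||||u|u j].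
- by rewrite tnth_mktuple -form_var; case: l l0 => [[|[|[|l]]] lt_l].
- by rewrite X0; apply: poly_of_homog.
- by rewrite X0 -on_map; apply: nonzero_cone.
- exact: nonzero_plane.
- have := identical_sound 3 cl; rewrite [form 3 0%E]val9_0 => e.
  have {}e := congr1 (meval u) e; rewrite meval0 in e.
  rewrite /cone -[RHS]e !big_ord_recl big_ord0 addr0 !addrA !tnth_mktuple.
  by rewrite -!rmorphXn -!rmorphD.
have /(identical_sound 3) e := Fl j (ltac:(by rewrite mem_iota ltn_ord)).
rewrite tnth_mktuple -comp_mpoly_meval -(form_subst 3 _ sz) e.
by rewrite formM mevalM tnth_mktuple.
Qed.

Let reps := [seq forms 4 3 g | g <- ct_map ct :: ct_reps ct].

Let reps_proportional : {in reps, forall G, proportional X F G}.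
Proof.
have I0 p : p - p \in I.
  by rewrite subrr; apply/(fermat_idealP char3) => v _; rewrite meval0.
have IN p q : p - q \in I -> q - p \in I.
  by rewrite -[q - p]opprB -[- (p - q)]mulN1r; apply: idealM.
have minors (p q : nat -> {mpoly k[4]}) :
    p 0%N * q 1%N - p 1%N * q 0%N \in I ->
    p 0%N * q 2%N - p 2%N * q 0%N \in I ->
    p 1%N * q 2%N - p 2%N * q 1%N \in I ->
  forall j l : 'I_3, p j * q l - p l * q j \in I.
  move=> e01 e02 e12 [[|[|[|j]]] lt_j] [[|[|[|l]]] lt_l] //=;
    by [apply: I0 | apply: IN].
have cross f g :
    proportional_expr f g -> proportional X (forms 4 3 f) (forms 4 3 g).
  case/and4P=> /onX_sound + /onX_sound + /onX_sound + _ j l.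
  rewrite !formM !tnth_mktuple => e01 e02 e12.
  exact: (minors (fun m => form 4 (nth 0%E f m))
    (fun m => form 4 (nth 0%E g m)) e01 e02 e12).
move=> G /(nthP F) [j]; rewrite size_map => lt_j <-.
rewrite (nth_map [::]) //; case: j lt_j => [_ j l|j lt_j] /=.
  by rewrite [X in _ - X]mulrC; apply: I0.
case/and4P: reps_ok => _ _ _ /(all_nthP [::])/(_ j lt_j).
by case/and3P => _ _; apply: cross.
Qed.

Let reps_homog :
  {in reps, forall G, exists d, forall j, tnth G j \is d.-homog}.
Proof.
move=> G /(nthP F) [j]; rewrite size_map => lt_j <-.
rewrite (nth_map [::]) //; case: j lt_j => [_|j lt_j] /=.
  by exists (ct_deg ct); apply: F_homog.
case/and4P: reps_ok => _ _ _ /(all_nthP [::])/(_ j lt_j).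
by case/and3P => /eqP sz dg _; exists (ct_rep_deg ct); apply: forms_homog.
Qed.

(* At a common zero of all representatives, ct_bezout shows that the
   coordinates 1, 2, 3 are 0, and the equation of the cone that the first one
   is 0. *)
Let reps_cover P v : X P -> v \in val P -> v != 0 ->
  exists2 G, G \in reps & values G v != 0.
Proof.
move=> XP vP v0; apply: contrapT => noG.
pose value e := (form 4 e).@[v 0].
have value0 : value 0%E = 0 by rewrite /value form0 meval0.
have G0 m j : value (nth 0%E (nth [::] (ct_map ct :: ct_reps ct) m) j) = 0.
  set gs := _ :: _; have [le_m|lt_m] := leqP (size gs) m.
    by rewrite (nth_default [::] le_m) nth_nil.
  have [le_j|lt_j] := leqP 3 j.
    rewrite [nth 0%E _ j]nth_default //; apply: leq_trans le_j.
    case: m lt_m => [_|m lt_m]; first by rewrite /= F_size.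
    case/and4P: reps_ok => _ _ _ /(all_nthP [::])/(_ m lt_m).
    by case/and3P => /eqP /= ->.
  have [//|Gv] := eqVneq (values (forms 4 3 (nth [::] gs m)) v) 0; last first.
    case: noG; exists (forms 4 3 (nth [::] gs m)) => //.
    by rewrite -(nth_map [::] F) // mem_nth // size_map.
  by move=> /rowP/(_ (Ordinal lt_j)); rewrite !mxE tnth_mktuple.
have flat0 j : value (nth 0%E (flatten (ct_map ct :: ct_reps ct)) j) = 0.
  elim: (_ :: _) G0 j => [|g gs IH] g0 j /=; first by rewrite nth_nil.
  rewrite nth_cat; case: ifP => _; first exact: (g0 0%N).
  by apply: IH => m; apply: (g0 m.+1).
have comb0 c s : (forall j, value (nth 0%E s j) = 0) -> value (combine c s) = 0.
  elim: s c => [|b s IH] [|a c] s0 //; rewrite /combine /=.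
  rewrite /value formD formM mevalD mevalM [X in _ * X + _](s0 0%N) mulr0 add0r.
  apply: IH => j.
  exact: (s0 j.+1).
have cv : cone (v 0) by apply/(fermat_coneP vP v0).
have v_eq0 (j : 'I_3) : v 0 (lift ord0 j) = 0.
  have /allP/(_ (j : nat)) := bezout_ok; rewrite mem_iota ltn_ord => /(_ isT).
  move/onX_sound/(fermat_idealP char3)/(_ _ cv)/eqP; rewrite mevalB subr_eq0.
  rewrite [X in _ == X](comb0 _ _ flat0) formX.
  rewrite [form 4 (Var _)](form_var (lift ord0 j)) rmorphXn /= mevalXU.
  by rewrite expf_eq0 => /andP[_ /eqP].
case/eqP: v0; apply/rowP => j; rewrite mxE.
case: (unliftP ord0 j) => [l ->|->]; first exact: v_eq0.
have := cv; rewrite /cone big_ord_recl big1 => [|l _]; last first.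
  by rewrite v_eq0 expr0n.
by rewrite addr0 => /eqP; rewrite expf_eq0 => /eqP.
Qed.

Let irr := fermat_irreducible char3 i_sq.
Let T : {rmorphism {mpoly k[4]} -> {fraction (coord_ring irr)}} := to_frac irr.
Let c j := form 3 (nth 0%E (ct_quad ct) j).

Let quad_homog j : (j < 3)%N -> c j \is (ct_quad_deg ct).-homog.
Proof.
case/and5P: quad_ok => _ _ _ + _ lt_j; rewrite /of_degree all_map => /allP.
by move=> /(_ j); rewrite mem_iota => /(_ lt_j)/eqP; apply: poly_of_homog.
Qed.

Let disc_not_square A B :
  A ^+ 2 = (c 1 ^+ 2 - 4%:R * (c 2 * c 0)) * B ^+ 2 -> B = 0.
Proof.
case/and5P: disc_ok => lt_q odd_d avs nz /(identical_sound 3).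
rewrite formD formN !formM formX => eq_disc.
have -> : c 1 ^+ 2 - 4%:R * (c 2 * c 0)
    = form 3 (horner_expr (Ordinal lt_q) (ct_disc ct)).
  rewrite -[RHS]eq_disc -/(c _) (_ : 4%:R = 1) ?mul1r //.
  have := rmorph0 (@mpolyC 3 k); rewrite -(pcharf0 char3) rmorph_nat => three0.
  by rewrite -natr1 three0 add0r.
apply: (odd_not_square (q := axis (Ordinal lt_q)) (nonzero_plane nz)) => v dv.
by rewrite size_along_horner.
Qed.

Let coordP (j : 'I_4) : exists d' (a b p q r : {mpoly k[3]}),
  [/\ [/\ a \is d'.-homog, b \is d'.-homog, p \is d'.-homog, q \is d'.-homog
     & r \is d'.-homog], (a != 0) || (b != 0) &
   'X_j * ((a \mPo F) * form 4 (ct_l0 ct) + (b \mPo F) * form 4 (ct_l1 ct))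
     - ((p \mPo F) * form 4 (ct_l0 ct) ^+ 2
        + (q \mPo F) * (form 4 (ct_l0 ct) * form 4 (ct_l1 ct))
        + (r \mPo F) * form 4 (ct_l1 ct) ^+ 2) \in I].
Proof.
have /allP/(_ (j : nat)) := coord_ok; rewrite mem_iota ltn_ord => /(_ isT).
set r := nth 0%E _; case/and3P => hr nz.
move=> /onX_sound; rewrite form0 subr0 formD formN !(formM, formD) !formX.
rewrite !on_map form_var => rel.
have hr' l : (l < 5)%N -> form 3 (r l) \is (ct_coord_deg ct).-homog.
  move=> lt_l; move: hr; rewrite /of_degree all_map => /allP/(_ l).
  by rewrite mem_iota => /(_ lt_l)/eqP; apply: poly_of_homog.
exists (ct_coord_deg ct), (form 3 (r 0%N)), (form 3 (r 1%N)), (form 3 (r 2%N)),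
  (form 3 (r 3%N)), (form 3 (r 4%N)); split => //; first by split; apply: hr'.
by case/orP: nz => /nonzero_plane ->; rewrite ?orbT.
Qed.

Let degree2 (phi : {P | X P} -> proj k 2) :
  (forall j, given_by phi (tnth F j) F) -> has_degree phi 2.
Proof.
move=> phiF; split.
  case/and4P: reps_ok => d0 _ _ _.
  exact: (fermat_dominant d0 F_homog phiF F_inj).
exists irr; case/and5P: quad_ok => /eqP h0 /eqP h1 nz0 _ /andP[nz2 qv].
have eqT p : (T p == 0) = (p \in I) by exact: to_frac_eq0.
have -> : @pullback_field _ _ _ irr _ phi = pullback_frac T F.
  apply: funext => f; apply/propext.
  exact: (pullback_fieldE irr eqT F0 F_inj phiF).
move: qv => /onX_sound; rewrite form0 subr0 !(formD, formM) !formX !on_map.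
move=> qv.
exact: (degree_two eqT F_inj (@poly_of_homog _ i 4 _ _ h0)
  (@poly_of_homog _ i 4 _ _ h1) (nonzero_cone nz0) (quad_homog (isT : 0 < 3)%N)
  (quad_homog (isT : 1 < 3)%N) (quad_homog (isT : 2 < 3)%N) (nonzero_plane nz2)
  qv disc_not_square coordP).
Qed.

Let affine_vectorE (c' : 'I_3 -> k) (j : 'I_4) :
  affine_vector c' 0 j = if unlift ord_max j is Some l then c' l else 1.
Proof.
rewrite mxE; case: (unliftP ord_max j) => [l ->|->].
  have bump_l : bump 3 l = l by rewrite /bump leqNgt ltn_ord.
  case: insubP => [l' _ e|]; first by congr c'; apply: val_inj; rewrite e.
  by rewrite /= bump_l ltn_ord.
by case: insubP => [l' _ e|] //=; have := ltn_ord l'; rewrite e.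
Qed.

Let affine_vector_neq0 c' : affine_vector c' != 0 :> 'rV[k]_4.
Proof.
apply: contraTneq (oner_neq0 k) => /rowP/(_ ord_max).
by rewrite affine_vectorE unlift_none mxE => ->; rewrite eqxx.
Qed.

(** A valid certificate proves the result for the polynomials A obtained from
    the forms ct_map by setting the last coordinate to 1. *)
Lemma certificate_sound (A : 'I_3 -> {mpoly k[3]}) :
    (forall j, A j =
       eval i%:MP [:: 'X_0; 'X_1; 'X_2%:R; 1] (nth 0%E (ct_map ct) j)) ->
  exists phi : {P : proj k 3 | X P} -> proj k 2,
    [/\ is_morphism phi, rational_map_induces A phi & has_degree phi 2].
Proof.
move=> eqA.
have affine j c' : (A j).@[c'] = (tnth F j).@[affine_vector c' 0].
  rewrite eqA rmorph_eval tnth_mktuple poly_of_meval /= mevalC !mevalXU meval1.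
  congr (eval _ _ _).
  apply: (@eq_from_nth _ 0) => [|l]; rewrite ?size_map_enum //.
  move=> lt_l; rewrite nth_map_enum affine_vectorE.
  case: (unliftP ord_max (Ordinal lt_l))
    => [[l' lt_l'] /(congr1 val)|/(congr1 val)] /= ->; last by [].
  by rewrite /bump leqNgt lt_l' /=; case: l' lt_l' => [|[|[|l']]] lt_l' //;
    congr c'; apply: val_inj.
have [phi [morph phiF]] :=
  morphism_of_representatives irr F0 reps_proportional reps_homog reps_cover.
have F_reps : F \in reps by rewrite inE eqxx.
exists phi; split=> //; last by apply: degree2 => j; apply: phiF.
split; last first.
  move=> P c' cP [j Aj].
  have [_ _ ev] := phiF F F_reps j.
  rewrite (ev P _ _ cP (affine_vector_neq0 c')).
    by congr <[_]>%VS; apply/rowP => l; rewrite !mxE affine.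
  move=> /(vanishes_homog (F_homog j) cP (affine_vector_neq0 c'))/eqP.
  by rewrite -affine (negPf Aj).
case/and5P: points_ok => /eqP sz _ /eq9_eq last1 _ nz.
pose c' (l : 'I_3) := cone_pt (lift ord_max l).
have ec : affine_vector c' 0 =1 cone_pt.
  move=> j; rewrite affine_vectorE; case: unliftP => [l ->//|->].
  by rewrite /cone_pt /point9 last1 val9_1.
exists (point (affine_vector_neq0 c')), c'; split.
- apply/(@fermat_coneP _ (point (affine_vector_neq0 c')) _ (memv_line _)
    (affine_vector_neq0 c')).
  by rewrite /cone -[RHS]cone_pt_cone; apply: eq_bigr => j _; rewrite ec.
- exact: memv_line.
exists 0; rewrite affine (meval_eq _ ec) tnth_mktuple.
exact: nonzero_sound sz nz.
Qed.

End Certificate.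
End Soundness.

(** * The two certificates *)

Section Data.

(* w, x, y, z are the coordinates on the space and u0, u1, u2 those on the
   plane. *)
Local Notation i := (Cst (Z3, P3)).
Local Notation w := (Var 0).
Local Notation x := (Var 1).
Local Notation y := (Var 2).
Local Notation z := (Var 3).
Local Notation u0 := (Var 0).
Local Notation u1 := (Var 1).
Local Notation u2 := (Var 2).

(** The homogenisations of degree 3 of F10, F11, F12. *)
Definition map1 : seq expr := [::
    (1 + i) * w ^+ 3 - i * w ^+ 2 * x + w ^+ 2 * y + (1 + i) * w * x ^+ 2
    + (1 + i) * w * x * y - (1 - i) * w * x * z - (1 - i) * w * y ^+ 2
    + i * w * y * z + (1 + i) * w * z ^+ 2 - i * x ^+ 3
    + (1 + i) * x ^+ 2 * y - x ^+ 2 * z - (1 + i) * x * y ^+ 2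
    + i * x * y * z + (1 - i) * x * z ^+ 2 + i * y ^+ 3 - i * y ^+ 2 * z
    - y * z ^+ 2 + (1 + i) * z ^+ 3;
    - w ^+ 3 + (1 - i) * w ^+ 2 * x - (1 + i) * w ^+ 2 * y
    - (1 - i) * w ^+ 2 * z + w * x ^+ 2 - (1 + i) * w * x * y
    - (1 - i) * w * x * z - i * w * y ^+ 2 - (1 + i) * w * y * z
    - i * x ^+ 3 + x ^+ 2 * y - (1 - i) * x ^+ 2 * z - x * y ^+ 2
    - x * y * z - (1 + i) * x * z ^+ 2 + (1 - i) * y ^+ 3
    - (1 + i) * y ^+ 2 * z - (1 - i) * y * z ^+ 2 + (1 - i) * z ^+ 3;
    i * w ^+ 3 - i * w ^+ 2 * y - w ^+ 2 * z - (1 + i) * w * x ^+ 2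
    - w * x * y - w * x * z + (1 - i) * w * y ^+ 2 + (1 + i) * w * z ^+ 2
    + i * x ^+ 3 - i * x ^+ 2 * z - i * x * y * z - i * x * z ^+ 2
    + (1 + i) * y ^+ 3 + i * y ^+ 2 * z - y * z ^+ 2]%E.

Definition reps1 : seq (seq expr) := [::
  [::
    - (1 - i) * w ^+ 3 + (1 - i) * w ^+ 2 * x + i * w ^+ 2 * z
    + (1 - i) * w * x ^+ 2 - (1 - i) * w * x * y - (1 - i) * w * y ^+ 2
    - i * w * y * z - (1 + i) * w * z ^+ 2 - (1 - i) * x ^+ 2 * y
    - (1 + i) * x * y ^+ 2 - (1 + i) * x * y * z + (1 + i) * x * z ^+ 2
    - (1 - i) * y ^+ 3 + y ^+ 2 * z - (1 - i) * y * z ^+ 2 - z ^+ 3;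
    w ^+ 2 * x + i * w ^+ 2 * y + w ^+ 2 * z + (1 + i) * w * x ^+ 2
    + i * w * x * y - (1 + i) * w * x * z + (1 - i) * w * y ^+ 2
    + i * w * y * z - (1 + i) * x ^+ 3 + (1 + i) * x ^+ 2 * y
    - (1 - i) * x ^+ 2 * z + (1 + i) * x * y ^+ 2 + (1 + i) * x * y * z
    - i * x * z ^+ 2 - (1 - i) * y * z ^+ 2 + i * z ^+ 3;
    - (1 + i) * w ^+ 2 * x - i * w ^+ 2 * y - w ^+ 2 * z - i * w * x ^+ 2
    + (1 + i) * w * x * y - (1 + i) * w * x * z - (1 - i) * w * y ^+ 2
    + x ^+ 3 + x ^+ 2 * y + (1 + i) * x ^+ 2 * z + x * z ^+ 2 + y ^+ 3
    + y ^+ 2 * z - i * y * z ^+ 2 - i * z ^+ 3]%E;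
  [::
    w ^+ 3 + (1 + i) * w ^+ 2 * y - i * w ^+ 2 * z + w * x ^+ 2
    - i * w * x * y - (1 + i) * w * x * z - (1 - i) * w * y ^+ 2
    - (1 - i) * w * y * z + (1 - i) * w * z ^+ 2 - x ^+ 3
    + i * x ^+ 2 * y + (1 - i) * x * y * z - i * x * z ^+ 2 - i * y ^+ 3
    + i * y ^+ 2 * z + (1 + i) * y * z ^+ 2 + (1 + i) * z ^+ 3;
    - (1 - i) * w ^+ 3 + w ^+ 2 * x + i * w * x ^+ 2 + i * w * x * y
    - i * w * x * z + (1 + i) * w * y ^+ 2 + w * y * z - w * z ^+ 2
    - x ^+ 3 + (1 + i) * x ^+ 2 * y - (1 + i) * x ^+ 2 * z
    + (1 - i) * x * y ^+ 2 + x * z ^+ 2 - i * y ^+ 3 - i * y ^+ 2 * z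
    - (1 - i) * y * z ^+ 2 + (1 - i) * z ^+ 3;
    (1 + i) * w ^+ 3 - (1 + i) * w ^+ 2 * y - (1 - i) * w ^+ 2 * z
    + i * w * x ^+ 2 + i * w * x * y + i * w * x * z + i * w * y ^+ 2
    + x ^+ 3 - i * x ^+ 2 * y - (1 + i) * x ^+ 2 * z
    + (1 + i) * x * y ^+ 2 - (1 - i) * y ^+ 3 + y ^+ 2 * z
    + (1 + i) * y * z ^+ 2 - i * z ^+ 3]%E].

Definition bezout1 : seq (seq expr) := [::
  [::
    - (1 + i) * w ^+ 2 + (1 - i) * w * x + i * w * y - (1 - i) * w * z
    + i * x ^+ 2 + (1 + i) * x * y - x * z - (1 - i) * y ^+ 2 - y * z
    + (1 + i) * z ^+ 2;
    - (1 - i) * w ^+ 2 + (1 + i) * w * x + w * z - (1 - i) * x * z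
    + (1 - i) * y ^+ 2 + (1 - i) * y * z - (1 - i) * z ^+ 2;
    w ^+ 2 - w * x + i * w * z;
    - (1 - i) * w * x + i * w * y - (1 - i) * w * z + i * x ^+ 2 - x * y
    - (1 + i) * x * z + (1 - i) * y ^+ 2 - (1 - i) * z ^+ 2;
    i * w ^+ 2 + i * w * x + (1 + i) * w * z + y ^+ 2 - (1 - i) * y * z
    + i * z ^+ 2;
    i * w ^+ 2 + i * w * x + w * z;
    - (1 + i) * w ^+ 2 - w * x - (1 - i) * x ^+ 2;
    (1 + i) * w ^+ 2 + i * w * x + x ^+ 2;
    0]%E;
  [::
    - (1 + i) * w ^+ 2 + i * w * x - i * w * y + (1 + i) * w * z
    - (1 - i) * x ^+ 2 - (1 + i) * x * y - (1 - i) * x * z - y ^+ 2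
    + (1 + i) * y * z - (1 - i) * z ^+ 2;
    (1 - i) * w ^+ 2 + (1 + i) * w * x + (1 - i) * w * z
    + (1 + i) * x ^+ 2 - (1 - i) * x * y + x * z - (1 - i) * y ^+ 2
    - i * z ^+ 2;
    - (1 + i) * w * x - w * z;
    (1 - i) * w * x + i * w * y - (1 - i) * w * z - (1 + i) * x ^+ 2
    - i * x * z - (1 + i) * y ^+ 2 - i * y * z + (1 + i) * z ^+ 2;
    - w * x - (1 + i) * w * y + (1 + i) * w * z + (1 - i) * x ^+ 2
    + (1 - i) * x * y - (1 + i) * x * z + y * z + (1 + i) * z ^+ 2;
    i * w ^+ 2 - i * w * x - w * z;
    - (1 + i) * w ^+ 2 - i * w * x - i * x ^+ 2;
    - (1 - i) * w ^+ 2 + w * x + i * x ^+ 2;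
    0]%E;
  [::
    - (1 + i) * w ^+ 2 + i * w * x + (1 + i) * w * y - (1 - i) * w * z
    - x * y - x * z - (1 - i) * y ^+ 2 - (1 + i) * y * z
    + (1 - i) * z ^+ 2;
    i * w * y + (1 - i) * x ^+ 2 - i * x * y + (1 + i) * y ^+ 2
    - i * y * z;
    - i * w ^+ 2 - w * x - (1 + i) * w * z;
    i * w ^+ 2 + (1 - i) * w * x - (1 + i) * w * y - (1 + i) * x ^+ 2
    + (1 - i) * x * y - i * y ^+ 2 + i * y * z + z ^+ 2;
    - i * w ^+ 2 + i * w * x - (1 + i) * w * y + (1 + i) * w * z + x ^+ 2
    + x * y + x * z + y ^+ 2 + y * z + z ^+ 2;
    w ^+ 2 - w * x + (1 + i) * w * z;
    w ^+ 2 - w * x + (1 + i) * x ^+ 2;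
    - w ^+ 2 - w * x - i * x ^+ 2;
    0]%E].

Definition quad1 : seq expr := [::
    u0 * (u0 * ((1 - i) * u0 + (1 + i) * u1 - (1 - i) * u2) + i * u1 ^+ 2
    + u2 ^+ 2) + u1 * (u1 * ((1 + i) * u1 - (1 - i) * u2) - (1 + i) * u2
    ^+ 2) + (1 - i) * u2 ^+ 3;
    u0 * (u0 * ((1 + i) * u0 - i * u1 - i * u2) - u1 ^+ 2) - i * u1 ^+ 2 *
    u2 + i * u2 ^+ 3;
    u0 * (u0 * (u0 + (1 + i) * u1) + (1 - i) * u1 ^+ 2)]%E.

Definition coord1 : seq (seq expr) := [::
  [::
    u0 * (u0 - (1 - i) * u1 - u2) + u1 * (- (1 - i) * u1 - i * u2) - i *
    u2 ^+ 2;
    - (1 - i) * u0 * u2 - (1 + i) * u1 * u2;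
    u0 * ((1 - i) * u0 - (1 - i) * u1) + u1 * (- i * u1 - (1 - i) * u2) +
    i * u2 ^+ 2;
    u0 * (- (1 - i) * u0 - i * u2) - u1 * u2 - i * u2 ^+ 2;
    - i * u0 * u2 + i * u2 ^+ 2]%E;
  [::
    u0 * (u0 - (1 - i) * u1 - u2) + u1 * (- (1 - i) * u1 - i * u2) - i *
    u2 ^+ 2;
    - (1 - i) * u0 * u2 - (1 + i) * u1 * u2;
    u0 * (- (1 + i) * u0 + i * u2) + (1 + i) * u1 * u2 - (1 - i) * u2 ^+ 2;
    (1 - i) * u0 * u1 + u1 * ((1 - i) * u1 + i * u2);
    - (1 - i) * u0 * u2 + (1 + i) * u1 * u2]%E;
  [::
    u0 * (u0 - (1 - i) * u1 - u2) + u1 * (- (1 - i) * u1 - i * u2) - i *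
    u2 ^+ 2;
    - (1 - i) * u0 * u2 - (1 + i) * u1 * u2;
    u0 * ((1 - i) * u0 - (1 + i) * u1 - u2) - i * u1 ^+ 2 - (1 - i) * u2
    ^+ 2;
    u0 * (i * u0 - i * u2) + i * u1 * u2 + (1 + i) * u2 ^+ 2;
    (1 + i) * u0 * u2 - (1 + i) * u2 ^+ 2]%E;
  [::
    u0 * (u0 - (1 + i) * u2) + u1 * (u1 - i * u2);
    (1 - i) * u0 ^+ 2 + (1 - i) * u1 ^+ 2;
    u0 * ((1 - i) * u0 + i * u1 - u2) + u1 * (i * u1 - u2);
    u0 * (u0 + (1 + i) * u1 - u2) + u1 * (- (1 + i) * u1 + (1 - i) * u2);
    u0 * ((1 + i) * u0 + u1) + u1 ^+ 2]%E].

(** The image of ct_line is the line of equation u0 = 0, and c1^2 - c0 c2 has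
    degree 5 in u1. *)
Definition certificate1 : certificate := {|
  ct_map := map1; ct_deg := 3;
  ct_reps := reps1; ct_rep_deg := 3; ct_exp := 5; ct_bezout := bezout1;
  ct_line := [:: u2; (1 - i) * u1; - (1 - i) * u2; - u1]%E;
  ct_factor := (- (1 - i) * u1 ^+ 2 - (1 - i) * u1 * u2 - (1 - i) * u2 ^+ 2)%E;
  ct_image := ((Z3, Z3), (Z3, Z3));
  ct_l0 := ((1 - i) * w + y)%E; ct_l1 := ((1 - i) * x + z)%E;
  ct_quad := quad1; ct_quad_deg := 3;
  ct_axis := 1;
  ct_disc := [:: - u0 ^+ 6 + u0 ^+ 4 * u2 ^+ 2 - u0 ^+ 2 * u2 ^+ 4 - u2 ^+ 6;
    - u0 ^+ 5;
    - u2 ^+ 4;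
    u0 ^+ 3 - u0 * u2 ^+ 2;
    - u2 ^+ 2;
    u0]%E;
  ct_coord := coord1; ct_coord_deg := 2;
  ct_cone_point := [:: (Z3, Z3); (Z3, Z3); (N3, P3); (P3, Z3)];
  ct_plane_point := [:: (P3, Z3); (Z3, Z3); (P3, Z3)]
|}.

(** The homogenisations of degree 5 of F20, F21, F22. *)
Definition map2 : seq expr := [::
    (1 - i) * w ^+ 3 * x ^+ 2 + (1 - i) * w ^+ 3 * x * y - w ^+ 3 * x * z
    - i * w ^+ 3 * y ^+ 2 + w ^+ 3 * y * z - (1 - i) * w ^+ 3 * z ^+ 2
    - i * w ^+ 2 * x ^+ 2 * z + (1 + i) * w ^+ 2 * x * y ^+ 2
    - (1 + i) * w ^+ 2 * x * y * z + w ^+ 2 * x * z ^+ 2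
    - w ^+ 2 * y ^+ 3 - w ^+ 2 * y * z ^+ 2 - (1 + i) * w ^+ 2 * z ^+ 3
    + (1 + i) * w * x ^+ 3 * y - w * x ^+ 3 * z
    - (1 + i) * w * x ^+ 2 * y ^+ 2 - w * x ^+ 2 * z ^+ 2
    - (1 + i) * w * x * y ^+ 3 - (1 - i) * w * x * y ^+ 2 * z
    + (1 - i) * w * x * y * z ^+ 2 - w * x * z ^+ 3 + i * w * y ^+ 4
    - (1 - i) * w * y ^+ 3 * z + (1 - i) * w * y ^+ 2 * z ^+ 2
    - i * w * y * z ^+ 3 - i * w * z ^+ 4 - i * x ^+ 5
    + i * x ^+ 3 * y ^+ 2 + x ^+ 3 * z ^+ 2 - (1 - i) * x ^+ 2 * y ^+ 3
    + x ^+ 2 * y ^+ 2 * z + x ^+ 2 * y * z ^+ 2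
    - (1 - i) * x ^+ 2 * z ^+ 3 + (1 - i) * x * y ^+ 4
    - (1 + i) * x * y ^+ 3 * z + (1 - i) * x * y ^+ 2 * z ^+ 2
    + (1 + i) * x * y * z ^+ 3 + (1 + i) * x * z ^+ 4 + (1 + i) * y ^+ 5
    - y ^+ 4 * z + (1 + i) * y ^+ 3 * z ^+ 2 - y * z ^+ 4 - z ^+ 5;
    w ^+ 3 * x ^+ 2 - i * w ^+ 3 * x * y - (1 - i) * w ^+ 3 * x * z
    + w ^+ 3 * y ^+ 2 + (1 - i) * w ^+ 3 * y * z - w ^+ 3 * z ^+ 2
    + w ^+ 2 * x ^+ 3 + w ^+ 2 * x ^+ 2 * y - w ^+ 2 * x * y ^+ 2
    + i * w ^+ 2 * x * y * z + i * w ^+ 2 * x * z ^+ 2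
    + i * w ^+ 2 * y ^+ 3 + (1 - i) * w ^+ 2 * y ^+ 2 * z
    - (1 + i) * w ^+ 2 * y * z ^+ 2 - (1 + i) * w ^+ 2 * z ^+ 3
    + (1 - i) * w * x ^+ 4 + (1 + i) * w * x ^+ 3 * y - w * x ^+ 3 * z
    - w * x ^+ 2 * y ^+ 2 + (1 - i) * w * x ^+ 2 * y * z
    + (1 + i) * w * x ^+ 2 * z ^+ 2 + (1 + i) * w * x * y ^+ 3
    + (1 - i) * w * x * y ^+ 2 * z - (1 - i) * w * x * y * z ^+ 2
    + w * x * z ^+ 3 - i * w * y ^+ 4 + (1 - i) * w * y ^+ 3 * z
    - i * w * y ^+ 2 * z ^+ 2 + (1 + i) * w * y * z ^+ 3 + i * w * z ^+ 4
    - i * x ^+ 5 + x ^+ 4 * y + (1 - i) * x ^+ 4 * z - i * x ^+ 3 * y * z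
    - x ^+ 3 * z ^+ 2 - (1 + i) * x ^+ 2 * y ^+ 2 * z
    - (1 - i) * x ^+ 2 * y * z ^+ 2 + (1 + i) * x ^+ 2 * z ^+ 3
    - i * x * y ^+ 4 - i * x * y ^+ 3 * z - (1 + i) * x * y ^+ 2 * z ^+ 2
    - (1 + i) * x * y * z ^+ 3 + y ^+ 5 + i * y ^+ 4 * z
    + y ^+ 3 * z ^+ 2 - i * y ^+ 2 * z ^+ 3 + (1 - i) * y * z ^+ 4
    - (1 - i) * z ^+ 5;
    - i * w ^+ 3 * x ^+ 2 - (1 - i) * w ^+ 3 * x * y + i * w ^+ 3 * x * z
    - w ^+ 3 * y ^+ 2 + i * w ^+ 3 * y * z - w ^+ 3 * z ^+ 2
    - i * w ^+ 2 * x ^+ 2 * y - (1 - i) * w ^+ 2 * x ^+ 2 * z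
    - (1 + i) * w ^+ 2 * x * y ^+ 2 + w ^+ 2 * x * y * z
    - i * w ^+ 2 * x * z ^+ 2 - (1 - i) * w ^+ 2 * y ^+ 2 * z
    - (1 - i) * w ^+ 2 * y * z ^+ 2 + i * w ^+ 2 * z ^+ 3
    - (1 + i) * w * x ^+ 4 + (1 + i) * w * x ^+ 3 * y - w * x ^+ 3 * z
    + i * w * x ^+ 2 * y ^+ 2 + (1 - i) * w * x ^+ 2 * y * z
    - w * x ^+ 2 * z ^+ 2 - w * x * y ^+ 3 + (1 + i) * w * x * y ^+ 2 * z
    + w * x * y * z ^+ 2 - (1 + i) * w * x * z ^+ 3 - w * y ^+ 4
    + i * w * y ^+ 3 * z + (1 + i) * w * y ^+ 2 * z ^+ 2
    + i * w * y * z ^+ 3 - (1 + i) * w * z ^+ 4 + x ^+ 5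
    + (1 - i) * x ^+ 4 * y - (1 + i) * x ^+ 4 * z + i * x ^+ 3 * y ^+ 2
    + x ^+ 3 * z ^+ 2 - (1 - i) * x ^+ 2 * y ^+ 3 + x ^+ 2 * y * z ^+ 2
    - (1 - i) * x ^+ 2 * z ^+ 3 - x * y ^+ 4 + x * y ^+ 3 * z
    - (1 + i) * x * y ^+ 2 * z ^+ 2 - (1 + i) * x * y * z ^+ 3
    - (1 + i) * x * z ^+ 4 - y ^+ 5 + (1 - i) * y ^+ 4 * z
    - y ^+ 3 * z ^+ 2 - (1 - i) * y * z ^+ 4 + (1 - i) * z ^+ 5]%E.

Definition reps2 : seq (seq expr) := [::
  [::
    - (1 - i) * w ^+ 3 * x ^+ 3 - i * w ^+ 3 * x ^+ 2 * y
    + i * w ^+ 3 * x ^+ 2 * z + (1 - i) * w ^+ 3 * x * z ^+ 2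
    - (1 - i) * w ^+ 3 * y ^+ 2 * z + w ^+ 3 * z ^+ 3
    + (1 + i) * w ^+ 2 * x ^+ 4 - (1 - i) * w ^+ 2 * x ^+ 3 * y
    + (1 - i) * w ^+ 2 * x ^+ 3 * z + w ^+ 2 * x ^+ 2 * y * z
    - (1 + i) * w ^+ 2 * x ^+ 2 * z ^+ 2 - (1 - i) * w ^+ 2 * x * y ^+ 3
    - (1 + i) * w ^+ 2 * x * y ^+ 2 * z + w ^+ 2 * y ^+ 3 * z
    + w ^+ 2 * y ^+ 2 * z ^+ 2 - i * w ^+ 2 * y * z ^+ 3
    - (1 - i) * w ^+ 2 * z ^+ 4 - (1 - i) * w * x ^+ 5
    - i * w * x ^+ 4 * y + w * x ^+ 4 * z + i * w * x ^+ 3 * y ^+ 2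
    + (1 - i) * w * x ^+ 3 * y * z + (1 + i) * w * x ^+ 3 * z ^+ 2
    + i * w * x ^+ 2 * y ^+ 3 - (1 - i) * w * x ^+ 2 * y ^+ 2 * z
    + i * w * x ^+ 2 * y * z ^+ 2 - (1 - i) * w * x ^+ 2 * z ^+ 3
    - (1 + i) * w * x * y ^+ 4 + i * w * x * y ^+ 3 * z
    - i * w * x * y ^+ 2 * z ^+ 2 - (1 - i) * w * x * y * z ^+ 3
    + i * w * x * z ^+ 4 - (1 - i) * w * y ^+ 5
    + (1 + i) * w * y ^+ 4 * z + (1 - i) * w * y ^+ 3 * z ^+ 2
    - i * w * y ^+ 2 * z ^+ 3 + w * z ^+ 5 + (1 - i) * x ^+ 6
    - (1 - i) * x ^+ 5 * y - (1 + i) * x ^+ 5 * z + i * x ^+ 4 * y ^+ 2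
    - x ^+ 4 * y * z - i * x ^+ 4 * z ^+ 2
    + (1 - i) * x ^+ 3 * y ^+ 2 * z - (1 + i) * x ^+ 3 * z ^+ 3
    + x ^+ 2 * y ^+ 4 - (1 - i) * x ^+ 2 * y ^+ 3 * z
    + i * x ^+ 2 * y * z ^+ 3 + (1 + i) * x ^+ 2 * z ^+ 4 + x * y ^+ 5
    - x * y ^+ 4 * z + x * y * z ^+ 4 - x * z ^+ 5 + y ^+ 5 * z
    + (1 + i) * y ^+ 4 * z ^+ 2 + y * z ^+ 5 + (1 + i) * z ^+ 6;
    - (1 - i) * w ^+ 3 * x ^+ 3 - i * w ^+ 3 * x ^+ 2 * y
    - (1 - i) * w ^+ 3 * x ^+ 2 * z - (1 - i) * w ^+ 3 * x * y ^+ 2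
    + w ^+ 3 * x * y * z + (1 - i) * w ^+ 3 * x * z ^+ 2
    + (1 + i) * w ^+ 3 * y ^+ 2 * z + (1 + i) * w ^+ 3 * y * z ^+ 2
    - w ^+ 3 * z ^+ 3 - w ^+ 2 * x ^+ 4 + i * w ^+ 2 * x ^+ 3 * y
    + (1 + i) * w ^+ 2 * x ^+ 3 * z - (1 + i) * w ^+ 2 * x ^+ 2 * y ^+ 2
    - (1 + i) * w ^+ 2 * x ^+ 2 * y * z - w ^+ 2 * x ^+ 2 * z ^+ 2
    - (1 + i) * w ^+ 2 * x * y ^+ 2 * z - w ^+ 2 * x * y * z ^+ 2
    + (1 + i) * w ^+ 2 * x * z ^+ 3 + i * w ^+ 2 * y ^+ 4
    + i * w ^+ 2 * y ^+ 3 * z + w ^+ 2 * y ^+ 2 * z ^+ 2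
    - (1 + i) * w ^+ 2 * y * z ^+ 3 + w ^+ 2 * z ^+ 4 - w * x ^+ 5
    + i * w * x ^+ 4 * y - w * x ^+ 4 * z + (1 - i) * w * x ^+ 3 * y ^+ 2
    - i * w * x ^+ 3 * z ^+ 2 + (1 - i) * w * x ^+ 2 * y ^+ 3
    - (1 - i) * w * x ^+ 2 * y ^+ 2 * z + i * w * x ^+ 2 * y * z ^+ 2
    + i * w * x ^+ 2 * z ^+ 3 + i * w * x * y ^+ 4 - w * x * y ^+ 3 * z
    + i * w * x * y ^+ 2 * z ^+ 2 - w * x * y * z ^+ 3
    - (1 + i) * w * x * z ^+ 4 + (1 - i) * w * y ^+ 4 * z
    + (1 - i) * w * y ^+ 3 * z ^+ 2 - (1 - i) * w * y ^+ 2 * z ^+ 3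
    - w * y * z ^+ 4 + (1 - i) * w * z ^+ 5 + (1 + i) * x ^+ 6
    - (1 + i) * x ^+ 5 * y - i * x ^+ 5 * z - x ^+ 4 * y ^+ 2
    - x ^+ 4 * y * z + i * x ^+ 4 * z ^+ 2 - x ^+ 3 * y ^+ 3
    - (1 + i) * x ^+ 3 * y * z ^+ 2 + i * x ^+ 3 * z ^+ 3
    + x ^+ 2 * y ^+ 3 * z - (1 - i) * x ^+ 2 * y ^+ 2 * z ^+ 2
    - (1 + i) * x ^+ 2 * y * z ^+ 3 + i * x ^+ 2 * z ^+ 4
    + (1 + i) * x * y ^+ 5 - x * y ^+ 4 * z + (1 + i) * x * y * z ^+ 4
    - x * z ^+ 5 + y ^+ 6 - (1 - i) * y ^+ 5 * z
    + (1 - i) * y ^+ 4 * z ^+ 2 + y ^+ 2 * z ^+ 4 - (1 - i) * y * z ^+ 5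
    + (1 - i) * z ^+ 6;
    - (1 - i) * w ^+ 3 * x ^+ 3 - (1 + i) * w ^+ 3 * x ^+ 2 * y
    - i * w ^+ 3 * x * y ^+ 2 + i * w ^+ 3 * x * y * z
    - w ^+ 3 * x * z ^+ 2 + (1 - i) * w ^+ 3 * y ^+ 3
    + w ^+ 3 * y ^+ 2 * z + (1 + i) * w ^+ 3 * y * z ^+ 2
    - i * w ^+ 3 * z ^+ 3 + (1 - i) * w ^+ 2 * x ^+ 4
    + i * w ^+ 2 * x ^+ 3 * y + (1 - i) * w ^+ 2 * x ^+ 3 * z
    - (1 - i) * w ^+ 2 * x ^+ 2 * y ^+ 2 + w ^+ 2 * x ^+ 2 * y * z
    + (1 - i) * w ^+ 2 * x ^+ 2 * z ^+ 2
    + (1 + i) * w ^+ 2 * x * y ^+ 2 * z - i * w ^+ 2 * x * z ^+ 3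
    - w ^+ 2 * y ^+ 4 + (1 - i) * w ^+ 2 * y ^+ 3 * z
    + w ^+ 2 * y ^+ 2 * z ^+ 2 + w ^+ 2 * y * z ^+ 3
    + i * w ^+ 2 * z ^+ 4 - i * w * x ^+ 5 - (1 + i) * w * x ^+ 4 * y
    + (1 + i) * w * x ^+ 4 * z - (1 - i) * w * x ^+ 3 * y ^+ 2
    + w * x ^+ 3 * y * z + i * w * x ^+ 3 * z ^+ 2 + w * x ^+ 2 * y ^+ 3
    - (1 + i) * w * x ^+ 2 * y ^+ 2 * z - i * w * x ^+ 2 * y * z ^+ 2
    + (1 + i) * w * x ^+ 2 * z ^+ 3 - (1 + i) * w * x * y ^+ 3 * z
    - (1 - i) * w * x * y ^+ 2 * z ^+ 2 + w * x * y * z ^+ 3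
    - (1 + i) * w * x * z ^+ 4 - (1 + i) * w * y ^+ 5
    - i * w * y ^+ 4 * z - w * y ^+ 3 * z ^+ 2
    + (1 - i) * w * y ^+ 2 * z ^+ 3 - i * w * y * z ^+ 4 - w * z ^+ 5
    + x ^+ 5 * z - (1 - i) * x ^+ 4 * y ^+ 2 + x ^+ 4 * y * z
    + i * x ^+ 4 * z ^+ 2 + x ^+ 3 * y ^+ 3
    - (1 + i) * x ^+ 3 * y * z ^+ 2 + x ^+ 3 * z ^+ 3
    + (1 - i) * x ^+ 2 * y ^+ 4 - (1 + i) * x ^+ 2 * y ^+ 3 * z
    - i * x ^+ 2 * y ^+ 2 * z ^+ 2 + x ^+ 2 * y * z ^+ 3]%E;
  [::
    i * w ^+ 3 * x ^+ 3 - i * w ^+ 3 * x ^+ 2 * y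
    - (1 - i) * w ^+ 3 * x ^+ 2 * z + (1 - i) * w ^+ 3 * x * y ^+ 2
    - (1 - i) * w ^+ 3 * x * y * z - (1 - i) * w ^+ 3 * x * z ^+ 2
    - w ^+ 3 * y ^+ 3 + (1 - i) * w ^+ 3 * y ^+ 2 * z
    - (1 + i) * w ^+ 3 * z ^+ 3 - (1 + i) * w ^+ 2 * x ^+ 4
    - (1 - i) * w ^+ 2 * x ^+ 3 * y + i * w ^+ 2 * x ^+ 3 * z
    + i * w ^+ 2 * x ^+ 2 * y * z + i * w ^+ 2 * x ^+ 2 * z ^+ 2
    + (1 + i) * w ^+ 2 * x * y ^+ 3 + i * w ^+ 2 * x * y ^+ 2 * z
    - w ^+ 2 * x * z ^+ 3 + i * w ^+ 2 * y ^+ 3 * z + i * w ^+ 2 * z ^+ 4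
    + (1 - i) * w * x ^+ 5 - w * x ^+ 4 * y - w * x ^+ 4 * z
    - i * w * x ^+ 3 * y ^+ 2 + (1 + i) * w * x ^+ 3 * y * z
    + (1 - i) * w * x ^+ 3 * z ^+ 2 - (1 - i) * w * x ^+ 2 * y ^+ 3
    + i * w * x ^+ 2 * y * z ^+ 2 + (1 + i) * w * x ^+ 2 * z ^+ 3
    + (1 - i) * w * x * y ^+ 3 * z + (1 - i) * w * x * y ^+ 2 * z ^+ 2
    + i * w * x * y * z ^+ 3 - (1 + i) * w * x * z ^+ 4 + i * w * y ^+ 5
    - i * w * y ^+ 4 * z + (1 + i) * w * y ^+ 3 * z ^+ 2
    + i * w * y ^+ 2 * z ^+ 3 - (1 - i) * w * y * z ^+ 4
    - (1 + i) * w * z ^+ 5 + (1 + i) * x ^+ 6 - x ^+ 5 * y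
    + (1 + i) * x ^+ 5 * z - i * x ^+ 4 * y ^+ 2
    + (1 + i) * x ^+ 4 * y * z + (1 + i) * x ^+ 4 * z ^+ 2
    - i * x ^+ 3 * y ^+ 3 + (1 - i) * x ^+ 3 * y ^+ 2 * z
    - i * x ^+ 3 * z ^+ 3 + (1 - i) * x ^+ 2 * y ^+ 4
    - (1 + i) * x ^+ 2 * y ^+ 3 * z - i * x ^+ 2 * y ^+ 2 * z ^+ 2
    + (1 - i) * x ^+ 2 * y * z ^+ 3 - (1 - i) * x ^+ 2 * z ^+ 4
    + i * x * y ^+ 5 - i * x * y ^+ 4 * z + (1 + i) * x * y ^+ 3 * z ^+ 2
    + i * x * y ^+ 2 * z ^+ 3 + (1 + i) * x * y * z ^+ 4
    - (1 - i) * x * z ^+ 5 + (1 - i) * y ^+ 6 - y ^+ 5 * z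
    + i * y ^+ 4 * z ^+ 2 - i * y ^+ 3 * z ^+ 3 - i * y ^+ 2 * z ^+ 4
    + (1 + i) * y * z ^+ 5;
    (1 - i) * w ^+ 3 * x ^+ 3 + (1 - i) * w ^+ 3 * x ^+ 2 * y
    - (1 + i) * w ^+ 3 * x ^+ 2 * z - (1 - i) * w ^+ 3 * x * y ^+ 2
    - i * w ^+ 3 * x * y * z + (1 - i) * w ^+ 3 * x * z ^+ 2
    + w ^+ 3 * y ^+ 3 + i * w ^+ 3 * y ^+ 2 * z - i * w ^+ 3 * y * z ^+ 2
    + (1 + i) * w ^+ 2 * x ^+ 3 * y + (1 + i) * w ^+ 2 * x ^+ 3 * z
    - w ^+ 2 * x ^+ 2 * y ^+ 2 + (1 - i) * w ^+ 2 * x ^+ 2 * y * z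
    - i * w ^+ 2 * x ^+ 2 * z ^+ 2 - i * w ^+ 2 * x * y ^+ 3
    + w ^+ 2 * x * y ^+ 2 * z - (1 - i) * w ^+ 2 * x * y * z ^+ 2
    + (1 + i) * w ^+ 2 * y ^+ 4 - (1 - i) * w ^+ 2 * y ^+ 3 * z
    - (1 + i) * w ^+ 2 * y ^+ 2 * z ^+ 2 - w ^+ 2 * y * z ^+ 3
    - i * w ^+ 2 * z ^+ 4 + (1 - i) * w * x ^+ 5
    + (1 - i) * w * x ^+ 4 * y - w * x ^+ 4 * z - w * x ^+ 3 * y ^+ 2
    + (1 - i) * w * x ^+ 3 * y * z + i * w * x ^+ 3 * z ^+ 2
    + i * w * x ^+ 2 * y ^+ 3 + i * w * x ^+ 2 * y ^+ 2 * z
    + (1 + i) * w * x ^+ 2 * z ^+ 3 - i * w * x * y ^+ 4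
    + (1 + i) * w * x * y ^+ 3 * z + i * w * x * y ^+ 2 * z ^+ 2
    - (1 + i) * w * x * y * z ^+ 3 + (1 - i) * w * x * z ^+ 4
    - i * w * y ^+ 5 + i * w * y ^+ 4 * z + (1 + i) * w * y ^+ 3 * z ^+ 2
    + i * w * y ^+ 2 * z ^+ 3 + i * w * y * z ^+ 4 - w * z ^+ 5 - x ^+ 6
    + x ^+ 5 * y - (1 - i) * x ^+ 5 * z + x ^+ 4 * y ^+ 2
    + (1 - i) * x ^+ 4 * y * z - (1 - i) * x ^+ 4 * z ^+ 2
    + x ^+ 3 * y ^+ 3 + (1 - i) * x ^+ 3 * y ^+ 2 * z
    - (1 + i) * x ^+ 3 * z ^+ 3 - x ^+ 2 * y ^+ 4
    + i * x ^+ 2 * y * z ^+ 3 + i * x ^+ 2 * z ^+ 4 + i * x * y ^+ 4 * z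
    - (1 - i) * x * y ^+ 3 * z ^+ 2 - (1 - i) * x * y ^+ 2 * z ^+ 3
    - x * y * z ^+ 4 - (1 - i) * x * z ^+ 5 + (1 - i) * y ^+ 6
    + (1 + i) * y ^+ 5 * z + (1 - i) * y ^+ 4 * z ^+ 2
    + (1 + i) * y ^+ 3 * z ^+ 3 - y ^+ 2 * z ^+ 4 + (1 - i) * y * z ^+ 5
    - i * z ^+ 6;
    i * w ^+ 3 * x ^+ 3 - w ^+ 3 * x ^+ 2 * y + i * w ^+ 3 * x ^+ 2 * z
    - i * w ^+ 3 * x * y * z + w ^+ 3 * x * z ^+ 2 + i * w ^+ 3 * y ^+ 3
    - (1 - i) * w ^+ 3 * y * z ^+ 2 + w ^+ 3 * z ^+ 3
    - (1 - i) * w ^+ 2 * x ^+ 3 * y + (1 - i) * w ^+ 2 * x ^+ 3 * z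
    - (1 - i) * w ^+ 2 * x ^+ 2 * y ^+ 2 - i * w ^+ 2 * x ^+ 2 * y * z
    + w ^+ 2 * x ^+ 2 * z ^+ 2 + w ^+ 2 * x * y ^+ 3
    + i * w ^+ 2 * x * y ^+ 2 * z - (1 + i) * w ^+ 2 * x * y * z ^+ 2
    - (1 + i) * w ^+ 2 * x * z ^+ 3 - (1 - i) * w ^+ 2 * y ^+ 2 * z ^+ 2
    - (1 + i) * w ^+ 2 * y * z ^+ 3 + (1 - i) * w ^+ 2 * z ^+ 4
    + (1 - i) * w * x ^+ 5 + (1 + i) * w * x ^+ 4 * y
    - (1 - i) * w * x ^+ 4 * z + (1 - i) * w * x ^+ 3 * y ^+ 2
    - i * w * x ^+ 3 * y * z + i * w * x ^+ 3 * z ^+ 2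
    - i * w * x ^+ 2 * y ^+ 3 + (1 - i) * w * x ^+ 2 * y ^+ 2 * z
    - (1 + i) * w * x ^+ 2 * y * z ^+ 2 - i * w * x ^+ 2 * z ^+ 3
    + i * w * x * y ^+ 4 - w * x * y ^+ 3 * z
    + (1 - i) * w * x * y ^+ 2 * z ^+ 2 + (1 - i) * w * x * z ^+ 4
    - w * y ^+ 5 + w * y ^+ 4 * z - w * y ^+ 3 * z ^+ 2
    - w * y ^+ 2 * z ^+ 3 + i * w * y * z ^+ 4 + w * z ^+ 5
    - (1 - i) * x ^+ 6 + (1 - i) * x ^+ 5 * y + i * x ^+ 5 * z
    - (1 + i) * x ^+ 4 * y ^+ 2 - (1 + i) * x ^+ 4 * z ^+ 2
    - (1 + i) * x ^+ 3 * y ^+ 3 + (1 - i) * x ^+ 3 * y ^+ 2 * z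
    - (1 + i) * x ^+ 2 * y ^+ 4 + x ^+ 2 * y ^+ 3 * z
    + (1 + i) * x ^+ 2 * y ^+ 2 * z ^+ 2 + y ^+ 5 * z]%E].

Definition bezout2 : seq (seq expr) := [::
  [::
    - w ^+ 3 * x + w ^+ 3 * y + (1 - i) * w ^+ 3 * z
    + (1 - i) * w ^+ 2 * x ^+ 2 + i * w ^+ 2 * x * z
    - (1 - i) * w ^+ 2 * y ^+ 2 - (1 + i) * w ^+ 2 * y * z
    - (1 - i) * w ^+ 2 * z ^+ 2 + i * w * x ^+ 3
    - (1 + i) * w * x ^+ 2 * y + i * w * x ^+ 2 * z
    - (1 + i) * w * x * y * z + (1 + i) * w * x * z ^+ 2
    + (1 - i) * w * y ^+ 3 - i * w * y ^+ 2 * z - (1 + i) * w * z ^+ 3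
    + (1 + i) * x ^+ 4 - i * x ^+ 3 * y - (1 + i) * x ^+ 3 * z
    - (1 + i) * x ^+ 2 * y ^+ 2 + i * x ^+ 2 * y * z + x ^+ 2 * z ^+ 2
    + i * x * y ^+ 2 * z + x * y * z ^+ 2 - i * y ^+ 4
    - (1 - i) * y ^+ 3 * z + (1 - i) * y ^+ 2 * z ^+ 2
    + (1 - i) * y * z ^+ 3;
    w ^+ 3 * x - (1 - i) * w ^+ 3 * y + (1 + i) * w ^+ 3 * z
    - (1 - i) * w ^+ 2 * x * y - (1 + i) * w ^+ 2 * x * z
    - i * w ^+ 2 * y * z + i * w ^+ 2 * z ^+ 2 - (1 + i) * w * x ^+ 3
    + (1 - i) * w * x ^+ 2 * y + i * w * x ^+ 2 * z
    + (1 + i) * w * x * y * z + (1 - i) * w * x * z ^+ 2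
    + (1 + i) * w * y ^+ 3 - i * w * y ^+ 2 * z + i * w * y * z ^+ 2
    - i * w * z ^+ 3 - (1 + i) * x ^+ 4 + (1 + i) * x ^+ 3 * y
    + x ^+ 3 * z + i * x ^+ 2 * y ^+ 2 + (1 + i) * x ^+ 2 * y * z
    - (1 - i) * x ^+ 2 * z ^+ 2 - (1 + i) * x * y ^+ 3 - x * y ^+ 2 * z
    + (1 + i) * x * y * z ^+ 2 + (1 - i) * x * z ^+ 3 - (1 + i) * y ^+ 4
    + (1 - i) * y ^+ 3 * z - (1 - i) * y ^+ 2 * z ^+ 2
    - (1 + i) * y * z ^+ 3 - z ^+ 4;
    - (1 + i) * w ^+ 3 * x - (1 + i) * w ^+ 3 * y + (1 - i) * w ^+ 3 * z
    - (1 + i) * w ^+ 2 * x * y;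
    i * w ^+ 3 - w ^+ 2 * x + (1 + i) * w ^+ 2 * y + (1 - i) * w ^+ 2 * z
    + i * w * x ^+ 2 - i * w * x * y + w * x * z + (1 - i) * w * y ^+ 2
    + (1 - i) * w * y * z + (1 + i) * w * z ^+ 2 + i * x ^+ 3
    + (1 - i) * x ^+ 2 * y - x * y ^+ 2 - (1 + i) * x * y * z
    - i * y ^+ 3 + (1 - i) * y ^+ 2 * z - i * y * z ^+ 2 + z ^+ 3;
    i * w ^+ 3 - i * w ^+ 2 * x + w ^+ 2 * y - w ^+ 2 * z
    - (1 - i) * w * x ^+ 2 + i * w * x * y - i * w * x * z + w * y ^+ 2
    + (1 - i) * w * y * z + w * z ^+ 2 + (1 - i) * x ^+ 2 * y
    - x ^+ 2 * z + (1 - i) * x * y ^+ 2 - x * y * z + x * z ^+ 2 + y ^+ 3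
    + i * y ^+ 2 * z + y * z ^+ 2 + (1 - i) * z ^+ 3;
    - w ^+ 3 - w ^+ 2 * x - w ^+ 2 * y - i * w ^+ 2 * z + w * x ^+ 2
    + (1 - i) * w * x * y - (1 - i) * w * x * z + w * y ^+ 2
    + (1 - i) * w * y * z - (1 + i) * w * z ^+ 2 + (1 + i) * x ^+ 3;
    - i * w ^+ 3 - w ^+ 2 * x - i * w ^+ 2 * y - i * w ^+ 2 * z
    - w * x ^+ 2 + (1 + i) * w * x * y - w * y ^+ 2 + w * y * z
    + (1 + i) * w * z ^+ 2 - x ^+ 3 - (1 - i) * x ^+ 2 * y - x * y ^+ 2
    + x * y * z - i * x * z ^+ 2 + (1 + i) * y ^+ 3 - y ^+ 2 * z
    - y * z ^+ 2 - i * z ^+ 3;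
    w ^+ 3 - w ^+ 2 * x - (1 - i) * w ^+ 2 * y + (1 - i) * w ^+ 2 * z
    + w * x * z + (1 + i) * w * y ^+ 2 + i * w * z ^+ 2 - i * x ^+ 3
    + (1 + i) * x ^+ 2 * y - i * x ^+ 2 * z - (1 - i) * x * y ^+ 2
    - x * y * z + i * y ^+ 3;
    - w ^+ 3 + (1 + i) * w ^+ 2 * y]%E;
  [::
    - w ^+ 3 * x + w ^+ 3 * z - w ^+ 2 * x ^+ 2
    + (1 + i) * w ^+ 2 * x * y - (1 + i) * w ^+ 2 * x * z
    + (1 + i) * w ^+ 2 * y ^+ 2 - (1 + i) * w ^+ 2 * y * z
    + (1 - i) * w ^+ 2 * z ^+ 2 - w * x ^+ 3 - (1 + i) * w * x ^+ 2 * y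
    - i * w * x ^+ 2 * z + (1 + i) * w * x * y ^+ 2 - i * w * x * y * z
    - (1 + i) * w * x * z ^+ 2 + (1 + i) * w * y ^+ 3
    - (1 + i) * w * y ^+ 2 * z - w * y * z ^+ 2 - w * z ^+ 3 + x ^+ 3 * y
    - (1 + i) * x ^+ 3 * z - (1 + i) * x ^+ 2 * y ^+ 2 + x ^+ 2 * y * z
    - x ^+ 2 * z ^+ 2 + x * y ^+ 3 + i * x * y * z ^+ 2 - i * x * z ^+ 3
    - (1 - i) * y ^+ 4 + y ^+ 3 * z - (1 - i) * y ^+ 2 * z ^+ 2
    - (1 + i) * y * z ^+ 3 + (1 - i) * z ^+ 4;
    (1 + i) * w ^+ 3 * x - w ^+ 3 * y + w ^+ 3 * z + i * w ^+ 2 * x ^+ 2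
    - (1 + i) * w ^+ 2 * x * y + (1 + i) * w ^+ 2 * x * z
    - i * w ^+ 2 * y ^+ 2 + i * w ^+ 2 * y * z - i * w ^+ 2 * z ^+ 2
    + i * w * x ^+ 2 * y - (1 + i) * w * x ^+ 2 * z
    - (1 - i) * w * x * y ^+ 2 + w * x * y * z - i * w * y ^+ 3
    + (1 - i) * w * y * z ^+ 2 + (1 - i) * w * z ^+ 3 - (1 - i) * x ^+ 4
    - (1 + i) * x ^+ 3 * y + i * x ^+ 3 * z + (1 - i) * x ^+ 2 * y ^+ 2
    - (1 + i) * x ^+ 2 * y * z + i * x ^+ 2 * z ^+ 2 - i * x * y ^+ 3
    - x * y ^+ 2 * z - (1 + i) * x * y * z ^+ 2 + (1 - i) * x * z ^+ 3
    - (1 + i) * y ^+ 4 + y ^+ 3 * z - i * y * z ^+ 3 - i * z ^+ 4;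
    (1 - i) * w ^+ 3 * x - (1 - i) * w ^+ 3 * y - i * w ^+ 3 * z
    + (1 - i) * w ^+ 2 * x ^+ 2 + (1 - i) * w ^+ 2 * x * y + x ^+ 4;
    - w ^+ 3 + (1 - i) * w ^+ 2 * x + (1 - i) * w ^+ 2 * y - w ^+ 2 * z
    - i * w * x ^+ 2 + i * w * x * y - (1 - i) * w * x * z
    - (1 + i) * w * y ^+ 2 + w * y * z + (1 - i) * w * z ^+ 2
    + i * x ^+ 3 + x ^+ 2 * y + (1 - i) * x * y ^+ 2
    - (1 + i) * x * y * z + i * x * z ^+ 2 + (1 - i) * y ^+ 3
    + y ^+ 2 * z + (1 + i) * y * z ^+ 2 - (1 + i) * z ^+ 3;
    - i * w ^+ 3 + (1 - i) * w ^+ 2 * x - (1 - i) * w ^+ 2 * y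
    - w ^+ 2 * z + w * x ^+ 2 + (1 + i) * w * x * y + (1 - i) * w * x * z
    + i * w * y ^+ 2 + (1 + i) * w * y * z - (1 + i) * w * z ^+ 2
    - x ^+ 3 + (1 - i) * x ^+ 2 * y + x ^+ 2 * z + (1 + i) * x * y ^+ 2
    + (1 - i) * x * y * z + (1 + i) * x * z ^+ 2 - i * y ^+ 3
    + y ^+ 2 * z + (1 - i) * y * z ^+ 2 + z ^+ 3;
    - w ^+ 3 - (1 + i) * w ^+ 2 * x - i * w ^+ 2 * y
    - (1 + i) * w ^+ 2 * z - i * w * x ^+ 2 + (1 - i) * w * x * y
    + i * w * x * z + (1 - i) * w * y ^+ 2 + i * w * y * z + w * z ^+ 2
    + i * x ^+ 3;
    (1 + i) * w ^+ 3 - (1 - i) * w ^+ 2 * y - (1 - i) * w ^+ 2 * z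
    - w * x ^+ 2 + (1 + i) * w * x * y - (1 - i) * w * y * z
    + i * w * z ^+ 2 - i * x ^+ 3 + x ^+ 2 * y - x ^+ 2 * z
    + (1 + i) * x * y ^+ 2 + i * x * y * z - i * x * z ^+ 2
    + (1 + i) * y ^+ 2 * z + (1 + i) * y * z ^+ 2 + i * z ^+ 3;
    (1 + i) * w ^+ 3 + (1 + i) * w ^+ 2 * x + (1 - i) * w ^+ 2 * z
    + (1 + i) * w * x ^+ 2 - w * x * y - (1 - i) * w * x * z
    + i * w * y ^+ 2 - i * w * z ^+ 2 + i * x ^+ 3 + (1 + i) * x ^+ 2 * y
    - (1 + i) * x ^+ 2 * z + (1 - i) * x * y ^+ 2 + (1 + i) * y ^+ 3;
    - (1 - i) * w ^+ 3 + w ^+ 2 * y]%E;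
  [::
    w ^+ 3 * x + (1 - i) * w ^+ 3 * y + w ^+ 3 * z - i * w ^+ 2 * x ^+ 2
    + (1 - i) * w ^+ 2 * x * y - w ^+ 2 * x * z
    - (1 + i) * w ^+ 2 * y ^+ 2 + w ^+ 2 * y * z + i * w ^+ 2 * z ^+ 2
    + i * w * x ^+ 3 + w * x ^+ 2 * y + w * x ^+ 2 * z
    + (1 - i) * w * x * y ^+ 2 - w * x * y * z - (1 + i) * w * x * z ^+ 2
    + w * y ^+ 2 * z + w * z ^+ 3 - x ^+ 4 + i * x ^+ 3 * y
    - i * x ^+ 3 * z - (1 + i) * x ^+ 2 * y ^+ 2
    - (1 - i) * x ^+ 2 * z ^+ 2 - i * x * y ^+ 3 - x * y * z ^+ 2
    - x * z ^+ 3 - y ^+ 4 - y ^+ 3 * z + i * y ^+ 2 * z ^+ 2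
    - (1 - i) * y * z ^+ 3 + (1 + i) * z ^+ 4;
    (1 - i) * w ^+ 3 * x + (1 - i) * w ^+ 3 * y
    - (1 + i) * w ^+ 2 * x ^+ 2 + i * w ^+ 2 * x * y
    - (1 + i) * w ^+ 2 * x * z + (1 - i) * w ^+ 2 * y ^+ 2
    - w ^+ 2 * y * z + (1 + i) * w ^+ 2 * z ^+ 2 - (1 + i) * w * x ^+ 3
    + (1 - i) * w * x ^+ 2 * y + (1 - i) * w * x ^+ 2 * z
    + (1 + i) * w * x * y * z - (1 + i) * w * x * z ^+ 2 - i * w * y ^+ 3
    + i * w * y ^+ 2 * z - (1 + i) * w * y * z ^+ 2 + i * w * z ^+ 3
    + (1 - i) * x ^+ 4 - x ^+ 3 * y - (1 + i) * x ^+ 3 * z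
    + (1 - i) * x ^+ 2 * y ^+ 2 - x ^+ 2 * z ^+ 2 + x * y ^+ 3
    + (1 + i) * x * y ^+ 2 * z + x * y * z ^+ 2 + (1 + i) * x * z ^+ 3
    - (1 - i) * y ^+ 4 - i * y ^+ 3 * z + i * y ^+ 2 * z ^+ 2
    + (1 + i) * y * z ^+ 3 + z ^+ 4;
    (1 - i) * w ^+ 3 * x + w ^+ 3 * y + i * w ^+ 3 * z
    - (1 - i) * w ^+ 2 * x ^+ 2 + (1 - i) * w ^+ 2 * x * y
    - i * w ^+ 2 * x * z;
    - w ^+ 2 * x - i * w ^+ 2 * y - i * w ^+ 2 * z - w * x ^+ 2
    - (1 - i) * w * x * y + (1 - i) * w * x * z - (1 - i) * w * y ^+ 2
    - w * y * z - x ^+ 3 + (1 + i) * x ^+ 2 * y + (1 - i) * x ^+ 2 * z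
    + (1 + i) * x * y ^+ 2 - i * x * y * z + (1 - i) * x * z ^+ 2
    - (1 + i) * y ^+ 3 + (1 - i) * y ^+ 2 * z - (1 + i) * y * z ^+ 2
    + i * z ^+ 3;
    - (1 - i) * w ^+ 3 + (1 + i) * w ^+ 2 * x + i * w ^+ 2 * y
    - i * w ^+ 2 * z + i * w * x ^+ 2 + (1 - i) * w * x * y
    + (1 + i) * w * x * z + (1 + i) * w * y ^+ 2 - i * w * y * z
    - i * w * z ^+ 2 + (1 + i) * x ^+ 3 - x ^+ 2 * y - x ^+ 2 * z
    + (1 + i) * x * y ^+ 2 - (1 + i) * x * y * z + x * z ^+ 2
    + (1 + i) * y ^+ 3 + (1 - i) * y ^+ 2 * z + (1 - i) * y * z ^+ 2
    + (1 + i) * z ^+ 3;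
    (1 + i) * w ^+ 3 - w ^+ 2 * x - w ^+ 2 * y + (1 - i) * w ^+ 2 * z
    + w * x ^+ 2 - w * x * y + w * x * z - (1 + i) * w * y ^+ 2
    + (1 + i) * w * y * z - w * z ^+ 2 - (1 + i) * x ^+ 3;
    (1 - i) * w ^+ 3 + (1 + i) * w ^+ 2 * y - i * w ^+ 2 * z + w * x ^+ 2
    - (1 - i) * w * x * y - (1 - i) * w * y ^+ 2 - (1 - i) * w * y * z
    + (1 - i) * w * z ^+ 2 - (1 + i) * x ^+ 3 - i * x ^+ 2 * y
    + x ^+ 2 * z - (1 - i) * x * y ^+ 2 - (1 - i) * x * y * z
    - (1 - i) * x * z ^+ 2 - y ^+ 3 - (1 - i) * y * z ^+ 2
    - (1 + i) * z ^+ 3;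
    - w ^+ 3 - i * w ^+ 2 * x - (1 - i) * w ^+ 2 * y
    + (1 - i) * w ^+ 2 * z + (1 - i) * w * x ^+ 2 - i * w * x * y
    - w * y ^+ 2 - (1 - i) * w * y * z - (1 - i) * w * z ^+ 2 - x ^+ 3
    + i * x ^+ 2 * y - i * x ^+ 2 * z + x * y ^+ 2 + i * x * y * z
    + i * y ^+ 3;
    - w ^+ 3 - (1 + i) * w ^+ 2 * y]%E].

Definition quad2 : seq expr := [::
    u0 * (u0 * (- i * u0 ^+ 2 - i * u1 * u2 - i * u2 ^+ 2) - i * u1 ^+ 2 *
    u2) + u1 * (- i * u1 ^+ 2 * u2 + i * u2 ^+ 3) - i * u2 ^+ 4;
    u0 * (u0 * ((1 + i) * u0 ^+ 2 - u1 * u2 + (1 + i) * u2 ^+ 2) + u1 * u1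
    * ((1 - i) * u1 - u2)) + u1 * (u1 * (- u1 * u2 + (1 - i) * u2 ^+ 2) +
    u2 ^+ 3) + (1 + i) * u2 ^+ 4;
    u0 * (u0 * (u0 ^+ 2 + (1 + i) * u1 * u2 + u2 ^+ 2) + u1 * u1 * ((1 +
    i) * u1 + (1 + i) * u2)) + u1 * (u1 * ((1 + i) * u1 * u2 + (1 + i) *
    u2 ^+ 2) - (1 + i) * u2 ^+ 3) + u2 ^+ 4]%E.

Definition coord2 : seq (seq expr) := [::
  [::
    u0 * (u0 * u2 + u1 ^+ 2) + u1 * (- u1 ^+ 2 - u2 ^+ 2) - u2 ^+ 3;
    u0 * ((1 - i) * u0 * u2 - u1 ^+ 2) + u1 * (u1 ^+ 2 + u2 ^+ 2) - (1 -
    i) * u2 ^+ 3;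
    u0 * (u0 * (u0 + u2) + u1 * (- u1 + u2) - u2 ^+ 2) + u1 * u1 * (- u1 +
    u2) - u2 ^+ 3;
    u0 * (i * u0 * u2 + u1 * ((1 + i) * u1 + (1 + i) * u2)) + u1 * (u1 *
    (- (1 - i) * u1 + (1 + i) * u2) - u2 ^+ 2) - i * u2 ^+ 3;
    u0 * (u0 * (- i * u0 + u2) + u1 * (- u1 + (1 - i) * u2) + i * u2 ^+ 2)
    + u1 * (u1 * (- (1 + i) * u1 + (1 - i) * u2) + i * u2 ^+ 2) - u2 ^+ 3]%E;
  [::
    u0 * (u0 * u2 + u1 ^+ 2) + u1 * (- u1 ^+ 2 - u2 ^+ 2) - u2 ^+ 3;
    u0 * ((1 - i) * u0 * u2 - u1 ^+ 2) + u1 * (u1 ^+ 2 + u2 ^+ 2) - (1 -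
    i) * u2 ^+ 3;
    u0 * (- u0 * u2 - u1 ^+ 2) + u1 * (u1 ^+ 2 + u2 ^+ 2) + u2 ^+ 3;
    u0 * (u0 * (u0 + i * u2) + u1 * (- u1 + u2) - u2 ^+ 2) + u1 * (u1 *
    (u1 + u2) + u2 ^+ 2) - i * u2 ^+ 3;
    u0 * (u0 * ((1 - i) * u0 + (1 - i) * u2) + u1 * (i * u1 - u2) - (1 -
    i) * u2 ^+ 2) + u1 * (u1 * (u1 - u2) - (1 - i) * u2 ^+ 2) - (1 - i) *
    u2 ^+ 3]%E;
  [::
    u0 * (u0 * u2 + u1 ^+ 2) + u1 * (- u1 ^+ 2 - u2 ^+ 2) - u2 ^+ 3;
    u0 * ((1 - i) * u0 * u2 - u1 ^+ 2) + u1 * (u1 ^+ 2 + u2 ^+ 2) - (1 -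
    i) * u2 ^+ 3;
    u0 * (- (1 - i) * u0 * u2 - (1 - i) * u1 ^+ 2) + u1 * ((1 - i) * u1 ^+
    2 + (1 - i) * u2 ^+ 2) + (1 - i) * u2 ^+ 3;
    u0 * (u0 * (- (1 + i) * u0 - (1 - i) * u2) + u1 * (i * u1 - (1 + i) *
    u2) + (1 + i) * u2 ^+ 2) + u1 * (u1 * (- i * u1 - (1 + i) * u2) - i *
    u2 ^+ 2) + (1 - i) * u2 ^+ 3;
    u0 * (u0 * (u0 + u2) + u1 * ((1 - i) * u1 + (1 + i) * u2) - u2 ^+ 2) +
    u1 * (u1 * (- (1 + i) * u1 + (1 + i) * u2) - u2 ^+ 2) - u2 ^+ 3]%E;
  [::
    u0 * (u0 * u2 + u1 ^+ 2) + u1 * (- u1 ^+ 2 - u2 ^+ 2) - u2 ^+ 3;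
    u0 * ((1 - i) * u0 * u2 - u1 ^+ 2) + u1 * (u1 ^+ 2 + u2 ^+ 2) - (1 -
    i) * u2 ^+ 3;
    u0 * (u0 * ((1 - i) * u0 + (1 - i) * u2) + u1 * (- (1 - i) * u1 + (1 -
    i) * u2) - (1 - i) * u2 ^+ 2) + u1 * u1 * (- (1 - i) * u1 + (1 - i) *
    u2) - (1 - i) * u2 ^+ 3;
    u0 * (- (1 - i) * u0 * u2 - u1 * u2) + u1 * (u1 * (- (1 + i) * u1 -
    u2) + (1 + i) * u2 ^+ 2) + (1 - i) * u2 ^+ 3;
    u0 * (u0 * (- (1 + i) * u0 - (1 - i) * u2) + u1 * ((1 + i) * u1 + i *
    u2) + (1 + i) * u2 ^+ 2) + u1 * (u1 * (- u1 + i * u2) - (1 - i) * u2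
    ^+ 2) + (1 - i) * u2 ^+ 3]%E].

(** The image of ct_line is the line of equation u0 = u2, and c1^2 - c0 c2 has
    degree 5 in u0. *)
Definition certificate2 : certificate := {|
  ct_map := map2; ct_deg := 5;
  ct_reps := reps2; ct_rep_deg := 6; ct_exp := 9; ct_bezout := bezout2;
  ct_line := [::
    - u1 + (1 + i) * u2; (1 - i) * u1; (1 + i) * u1 + i * u2; i * u1]%E;
  ct_factor := (- u1 ^+ 3 * u2 - u1 ^+ 2 * u2 ^+ 2)%E;
  ct_image := ((Z3, Z3), (P3, Z3));
  ct_l0 := ((1 + i) * x + y)%E; ct_l1 := (- (1 - i) * w + z)%E;
  ct_quad := quad2; ct_quad_deg := 4;
  ct_axis := 0;
  ct_disc := [::
    i * u1 ^+ 6 * u2 ^+ 2 - i * u1 ^+ 4 * u2 ^+ 4 - i * u1 ^+ 2 * u2 ^+ 6;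
    i * u1 ^+ 5 * u2 ^+ 2 - i * u1 ^+ 3 * u2 ^+ 4;
    i * u1 ^+ 6 - i * u1 ^+ 2 * u2 ^+ 4;
    0;
    - i * u1 ^+ 2 * u2 ^+ 2;
    i * u1 ^+ 3]%E;
  ct_coord := coord2; ct_coord_deg := 3;
  ct_cone_point := [:: (Z3, Z3); (Z3, Z3); (P3, P3); (P3, Z3)];
  ct_plane_point := [:: (Z3, Z3); (P3, Z3); (P3, Z3)]
|}.

End Data.

(** * The maps of degree two *)

(** Setting z = 1 in the forms of certificate1 gives back F10, F11, F12. *)
Lemma map1_affine (k : closedFieldType) (i : k) j :
  F1 i j = eval i%:MP [:: 'X_0; 'X_1; 'X_2%:R; 1] (nth 0%E map1 j).
Proof.
case: j => [[|[|[|j]]] lt_j] //; rewrite /F1 (tnth_nth 0) /= /val9 /=;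
  rewrite /F10 /F11 /F12; ring.
Qed.

(** Setting z = 1 in the forms of certificate2 gives back F20, F21, F22. *)
Lemma map2_affine (k : closedFieldType) (i : k) j :
  F2 i j = eval i%:MP [:: 'X_0; 'X_1; 'X_2%:R; 1] (nth 0%E map2 j).
Proof.
case: j => [[|[|[|j]]] lt_j] //; rewrite /F2 (tnth_nth 0) /= /val9 /=;
  rewrite /F20 /F21 /F22; ring.
Qed.

Theorem proposition1p1 (k : closedFieldType) (char3 : 3%N \in [pchar k])
    (i : k) (i_sq : i ^+ 2 = -1) (F : 'I_3 -> {mpoly k[3]})
    (F_nu : F = F1 i \/ F = F2 i) :
  exists phi : {P : proj k 3 | fermat_quartic P} -> proj k 2,
    [/\ is_morphism phi, rational_map_induces F phi & has_degree phi 2].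
Proof.
case: F_nu => ->.
- apply: (@certificate_sound _ i char3 i_sq certificate1); first by vm_compute.
  exact: map1_affine.
- apply: (@certificate_sound _ i char3 i_sq certificate2); first by vm_compute.
  exact: map2_affine.
Qed.
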